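(* Let $E: y^2+xy=x^3+x^2-2x$, $E': y^2+xy=x^3+x^2+8x+10$, $\phi:E\to E'$, $\phi(x,y)=\left(\frac{x^2-2}{x},\frac{x^2y+2x+2y}{x^2}\right)$, and $P=(2,2)\in E(\mathbb{Q})$. Let $k\ge3$ and let $A_k,B_k$ generate $E[2^k]$ and $C_k,D_k$ generate $E'[2^k]$ with $\phi(A_k)=C_k$ and $\phi(B_k)=2D_k$. Let $K_k$ be the field generated over $\mathbb{Q}$ by the coordinates of all $\beta\in E(\mathbb{C})$ with $2^k\beta=P$, and fix $\beta_k$ with $2^k\beta_k=P$. For $\sigma\in\mathrm{Gal}(K_k/\mathbb{Q})$ write $\sigma(A_k)=aA_k+bB_k$, $\sigma(B_k)=cA_k+dB_k$, $\sigma(\beta_k)=\beta_k+eA_k+fB_k$ with entries in $\mathbb{Z}/2^k\mathbb{Z}$, and $M=\begin{bmatrix}a&b\\c&d\end{bmatrix}$. Then $e\equiv0\pmod 2$ if and only if $\det(M)\equiv1$ or $7\pmod 8$.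
   Context: $E[2^k]$, $E'[2^k]$ are the $2^k$-torsion subgroups over $\mathbb{C}$; $K_k$ contains the coordinates of all points of $E[2^k]$ and is Galois over $\mathbb{Q}$. *)

(* Defs.v *)
From HB Require Import structures.
From mathcomp Require Import all_boot all_order all_algebra all_fingroup all_field.
From mathcomp Require Import reals complex ring.

Set Implicit Arguments.
Unset Strict Implicit.
Unset Printing Implicit Defensive.

Import GRing.Theory.
Local Open Scope ring_scope.

(* y^2 + a1 x y + a3 y = x^3 + a2 x^2 + a4 x + a6 *)
Record weierstrass (F : Type) :=
  Weierstrass { wa1 : F; wa2 : F; wa3 : F; wa4 : F; wa6 : F }.

(* [None] is the point at infinity. *)
Definition plane_pt (F : Type) : Type := option (F * F).

Definition map_pt (F G : Type) (f : F -> G) (p : plane_pt F) : plane_pt G :=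
  omap (fun xy => (f xy.1, f xy.2)) p.

Definition is_coord (F : Type) (z : F) (p : plane_pt F) : Prop :=
  if p is Some (x, y) then z = x \/ z = y else False.

Section Weierstrass.
Variables (F : fieldType) (W : weierstrass F).
Local Notation a1 := (wa1 W).
Local Notation a2 := (wa2 W).
Local Notation a3 := (wa3 W).
Local Notation a4 := (wa4 W).
Local Notation a6 := (wa6 W).

Definition on_curve (p : plane_pt F) : bool :=
  if p is Some (x, y) then
    y ^+ 2 + a1 * x * y + a3 * y == x ^+ 3 + a2 * x ^+ 2 + a4 * x + a6
  else true.

Record ec_point := ECPoint { ec_val :> option (F * F); _ : on_curve ec_val }.
HB.instance Definition _ := [isSub for ec_val].
HB.instance Definition _ := [Choice of ec_point by <:].

Definition ec_zero : ec_point := @ECPoint None isT.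

Definition opp_pt (p : plane_pt F) : plane_pt F :=
  if p is Some (x, y) then Some (x, - y - a1 * x - a3) else None.

(* Chord and tangent law.  In the tangent case the denominator
   2 y1 + a1 x1 + a3 is nonzero, because the second point is then equal to the
   first one and different from its opposite. *)
Definition slope (x1 y1 x2 y2 : F) : F :=
  if x1 == x2
  then (3%:R * x1 ^+ 2 + 2%:R * a2 * x1 + a4 - a1 * y1)
         / (2%:R * y1 + a1 * x1 + a3)
  else (y2 - y1) / (x2 - x1).

Definition add_pt (p q : plane_pt F) : plane_pt F :=
  match p, q with
  | None, _ => q
  | _, None => p
  | Some (x1, y1), Some (x2, y2) =>
      if (x1 == x2) && (y1 == - y2 - a1 * x2 - a3) then None
      else let l := slope x1 y1 x2 y2 in
           let x3 := l ^+ 2 + a1 * l - a2 - x1 - x2 in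
           let y3 := l * (x3 - x1) + y1 in
           Some (x3, - y3 - a1 * x3 - a3)
  end.

Lemma opp_pt_on_curve p : on_curve p -> on_curve (opp_pt p).
Proof. by case: p => [[x y]|] //= /eqP <-; apply/eqP; ring. Qed.

Lemma add_pt_on_curve p q : on_curve p -> on_curve q -> on_curve (add_pt p q).
Proof.
case: p => [[x1 y1]|] //; case: q => [[x2 y2]|] // Hp Hq.
rewrite /add_pt; case: ifP => // /negbT Hn; set l := slope _ _ _ _.
apply: (@opp_pt_on_curve (Some (_, _))).
rewrite /on_curve in Hp Hq *; rewrite -subr_eq0 in Hp; rewrite -subr_eq0 in Hq.
rewrite -subr_eq0.
move: Hp Hq => /eqP Hp /eqP Hq; apply/eqP.
move: Hn @l; rewrite /slope; case: eqVneq => [e12|ne12] /= Hn.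
  subst x2.
  have Hprod : (y1 - y2) * (y1 + y2 + a1 * x1 + a3) = 0.
    rewrite -[RHS](subrr (0 : F)) -{1}Hp -{1}Hq; ring.
  have Hn' : y1 + y2 + a1 * x1 + a3 != 0.
    apply: contra Hn => /eqP H; apply/eqP.
    by apply/eqP; rewrite -subr_eq0 -H; apply/eqP; ring.
  have e12 : y1 = y2.
    apply/eqP; rewrite -subr_eq0; move/eqP: Hprod; rewrite mulf_eq0.
    by rewrite (negPf Hn') orbF.
  subst y2; set d := 2%:R * y1 + a1 * x1 + a3; set n := _ - a1 * y1.
  have Hd : d != 0.
    by apply: contra Hn' => /eqP H; rewrite -H /d; apply/eqP; ring.
  have Hl : n / d * d = n by rewrite mulfVK.
  move: (n / d) Hl => l; rewrite /n /d => /eqP Hl.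
  rewrite -subr_eq0 in Hl; move/eqP: Hl => Hl.
  rewrite -[RHS](addr0 (0 : F)) -{1}Hp.
  have -> : (0 : F) = (l ^+ 2 + a1 * l - a2 - x1 - x1 - x1) * 0 by rewrite mulr0.
  rewrite -Hl; ring.
have Hd : x2 - x1 != 0 by rewrite subr_eq0 eq_sym.
have Hl : (y2 - y1) / (x2 - x1) * (x2 - x1) = y2 - y1 by rewrite mulfVK.
move: ((y2 - y1) / (x2 - x1)) Hl => l Hl.
have {Hl}e2 : y2 = l * (x2 - x1) + y1 by rewrite Hl subrK.
subst y2; apply/eqP; rewrite -(inj_eq (mulfI Hd)) mulr0; apply/eqP.
set x3 := l ^+ 2 + _ - _ - _ - _.
rewrite -(addr0 (0 : F)).
rewrite -{1}(mulr0 (x2 - x3)) -{1}Hp -(mulr0 (x3 - x1)) -Hq /x3; ring.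
Qed.

Definition ec_opp (P : ec_point) : ec_point :=
  ECPoint (opp_pt_on_curve (valP P)).

Definition ec_add (P Q : ec_point) : ec_point :=
  ECPoint (add_pt_on_curve (valP P) (valP Q)).

Definition ec_mul (n : nat) (P : ec_point) : ec_point := iter n (ec_add P) ec_zero.

Definition ec_mulz (n : int) (P : ec_point) : ec_point :=
  match n with
  | Posz m => ec_mul m P
  | Negz m => ec_opp (ec_mul m.+1 P)
  end.

(* [A] and [B] generate the group of [n]-torsion points. *)
Definition gen_torsion (n : nat) (A B : ec_point) : Prop :=
  forall T : ec_point,
    ec_mul n T = ec_zero <->
    exists r s : int, T = ec_add (ec_mulz r A) (ec_mulz s B).

End Weierstrass.

Arguments ec_zero {F W}.

Definition E (F : fieldType) : weierstrass F := Weierstrass 1 1 0 (- 2%:R) 0.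

Definition E' (F : fieldType) : weierstrass F := Weierstrass 1 1 0 8%:R 10%:R.

Section Isogeny.
Variable F : fieldType.

Lemma P_on_curve : on_curve (E F) (Some (2%:R, 2%:R)).
Proof. by apply/eqP => /=; ring. Qed.

Definition P : ec_point (E F) := ECPoint P_on_curve.

(* The kernel of [phi] consists of the point at infinity and of (0, 0), the
   only point of E with x = 0. *)
Definition phi_pt (p : plane_pt F) : plane_pt F :=
  if p is Some (x, y) then
    if x == 0 then None
    else Some ((x ^+ 2 - 2%:R) / x,
               (x ^+ 2 * y + 2%:R * x + 2%:R * y) / x ^+ 2)
  else None.

Lemma phi_pt_on_curve p : on_curve (E F) p -> on_curve (E' F) (phi_pt p).
Proof.
case: p => [[x y]|] //; rewrite /phi_pt; case: eqVneq => // x0 /eqP /= H.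
rewrite -subr_eq0; apply/eqP.
apply: (@etrans _ _ ((x ^+ 2 + 2%:R) ^+ 2 / x ^+ 4
    * ((y ^+ 2 + 1 * x * y + 0 * y) -
       (x ^+ 3 + 1 * x ^+ 2 + - 2%:R * x + 0)))); last by rewrite H subrr mulr0.
by field.
Qed.

Definition phi (Q : ec_point (E F)) : ec_point (E' F) :=
  ECPoint (phi_pt_on_curve (valP Q)).

End Isogeny.

Arguments P {F}.

Section GaloisAction.
Variables (C : fieldType) (L : splittingFieldType rat) (iota : {rmorphism L -> C}).

(* The image of [iota] is the subfield of [C] generated over Q by [S]. *)
Definition generated_by (S : C -> Prop) : Prop :=
  (forall z, S z -> exists x : L, iota x = z) /\
  (forall K : {subfield L}, (forall x : L, S (iota x) -> x \in K) ->
     K = fullv :> {vspace L}).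

(* [sigma], seen as an automorphism of the image of [iota], maps the point [T]
   (whose coordinates must lie in this image) to [T']. *)
Definition galois_maps (sigma : gal_of {:L}) (T T' : plane_pt C) : Prop :=
  exists T0 : plane_pt L,
    map_pt iota T0 = T /\ map_pt iota (map_pt sigma T0) = T'.

End GaloisAction.

(* The coordinates of the points Q of E(C) such that 2^k Q = P. *)
Definition division_coord (C : fieldType) (k : nat) (z : C) : Prop :=
  exists Q : ec_point (E C), ec_mul (2 ^ k) Q = P /\ is_coord z Q.

(* Main.v *)
(** Put A = 2^(k-3) A_k and B = 2^(k-3) B_k, so that 4 B = (0, 0) is the kernel
    point of phi. For a 2-torsion point T with abscissa t, the function
    x(2 X) - t is the square of a function r_T, and translating X by a 2-torsion
    point S multiplies r_T by the Weil pairing e_2(S, T). Hence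
    (x(2 A) - x(2 B)) r_(4 A)(2 B) / (r_(4 B)(2 A) r_(4 B)(A) r_(4 A)(B))
    is a square root of 2, and the addition formula of the r_T shows how it
    depends on the basis: it is multiplied by the quadratic character (2 / det)
    under a change of basis of determinant det that preserves 4 B. This replaces
    the Weil pairing on the 8-torsion: sigma fixes the square roots of 2 if and
    only if det M is 1 or 7 modulo 8.
    On the other hand, for Q = 2^(k-1) beta_k one has 2 Q = P, the abscissa of
    phi(Q) is 4 +- 3 sqrt 2, and sigma(Q) differs from Q by e (4 A) + f (4 B), so
    sigma fixes this abscissa if and only if e is even. *)
Require Import Defs.
From HB Require Import structures.
From mathcomp Require Import all_boot all_order all_algebra all_fingroup all_field.
From mathcomp Require Import reals complex ring.

Set Implicit Arguments.
Unset Strict Implicit.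
Unset Printing Implicit Defensive.

Import Order.TTheory GRing.Theory Num.Theory.
Local Open Scope ring_scope.

(** * The group law of a smooth Weierstrass cubic *)

Section GroupLaw.
Variables (F : fieldType) (W : weierstrass F).
Local Notation a1 := (wa1 W).
Local Notation a2 := (wa2 W).
Local Notation a3 := (wa3 W).
Local Notation a4 := (wa4 W).
Local Notation a6 := (wa6 W).

(** The two expressions are the partial derivatives of the equation in y and, up to sign, in x. *)
Definition smooth : Prop := forall x y, on_curve W (Some (x, y)) ->
  2%:R * y + a1 * x + a3 = 0 ->
  3%:R * x ^+ 2 + 2%:R * a2 * x + a4 - a1 * y <> 0.

(* The line y = l x + c meets the curve at the abscissas x1, x2, x3, counted
   with multiplicity: comparison of the coefficients of
   X^3 + a2 X^2 + a4 X + a6 - (l X + c) (l X + c + a1 X + a3)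
   with those of (X - x1) (X - x2) (X - x3). *)
Definition line_meets (l c x1 x2 x3 : F) : Prop :=
  [/\ x3 = l ^+ 2 + a1 * l - a2 - x1 - x2,
      a4 = x1 * x2 + x1 * x3 + x2 * x3 + 2%:R * l * c + a1 * c + a3 * l
    & a6 = c ^+ 2 + a3 * c - x1 * x2 * x3].

Lemma line_meetsC l c x1 x2 x3 :
  line_meets l c x1 x2 x3 -> line_meets l c x2 x1 x3.
Proof. by rewrite /line_meets => -[-> -> ->]; split; ring. Qed.

Lemma line_meetsCA l c x1 x2 x3 :
  line_meets l c x1 x2 x3 -> line_meets l c x1 x3 x2.
Proof. by rewrite /line_meets => -[-> -> ->]; split; ring. Qed.

(** The reflected line carries the opposites of the three points. *)
Lemma line_meetsN l c x1 x2 x3 :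
  line_meets l c x1 x2 x3 -> line_meets (- l - a1) (- c - a3) x1 x2 x3.
Proof. by rewrite /line_meets => -[-> -> ->]; split; ring. Qed.

Lemma line_on_curve l c x1 x2 x3 :
  line_meets l c x1 x2 x3 -> on_curve W (Some (x1, l * x1 + c)).
Proof.
case=> e3 e4 e6; rewrite /on_curve e4 e6 e3; apply/eqP.
have -> : a2 = l ^+ 2 + a1 * l - x3 - x1 - x2 by rewrite e3; ring.
ring.
Qed.

(** Chord and tangent at once. When x1 = x2, [line_meets] makes the numerator of the tangent slope l
    times its denominator, so a zero denominator would give a singular point. *)
Lemma add_line l c x1 x2 x3 : smooth -> line_meets l c x1 x2 x3 ->
  add_pt W (Some (x1, l * x1 + c)) (Some (x2, l * x2 + c)) =
  opp_pt W (Some (x3, l * x3 + c)).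
Proof.
move=> sm h; rewrite /add_pt /slope.
suff sl : (if x1 == x2 then
    ((l * x1 + c) != - (l * x2 + c) - a1 * x2 - a3) /\
     (3%:R * x1 ^+ 2 + 2%:R * a2 * x1 + a4 - a1 * (l * x1 + c))
         / (2%:R * (l * x1 + c) + a1 * x1 + a3) = l
   else (l * x2 + c - (l * x1 + c)) / (x2 - x1) = l).
  case: (eqVneq x1 x2) sl => [e12 [/negPf -> ->]|n12 ->] /=.
    by case: h => -> _ _; rewrite -e12; congr (Some (_, _)); ring.
  by case: h => -> _ _; congr (Some (_, _)); ring.
case: eqVneq => [e12|n12]; last first.
  by field; rewrite subr_eq0 eq_sym.
have hd : (3%:R * x1 ^+ 2 + 2%:R * a2 * x1 + a4 - a1 * (l * x1 + c))
     = l * (2%:R * (l * x1 + c) + a1 * x1 + a3).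
  have e2 : a2 = l ^+ 2 + a1 * l - x1 - x2 - x3 by case: h => -> _ _; ring.
  by case: h => _ -> _; rewrite e2 -e12; ring.
have n0 : 2%:R * (l * x1 + c) + a1 * x1 + a3 != 0.
  apply/eqP => d0; apply: (sm _ _ (line_on_curve h) d0).
  by rewrite hd d0 mulr0.
split; last by rewrite hd mulfK.
apply: contra n0 => /eqP e; apply/eqP; rewrite -e12 in e.
by rewrite mulrDl !mul1r {1}e; ring.
Qed.

(** With x3 taken from the sum of the roots and a6 from the first point, only a4 is left to
    identify: for a chord it comes from the difference of the two equations, for a tangent from the
    slope. *)
Lemma add_meets x1 y1 x2 y2 (l := slope W x1 y1 x2 y2) (c := y1 - l * x1) :
  on_curve W (Some (x1, y1)) -> on_curve W (Some (x2, y2)) ->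
  ~~ ((x1 == x2) && (y1 == - y2 - a1 * x2 - a3)) ->
  exists x3, [/\ line_meets l c x1 x2 x3, y1 = l * x1 + c & y2 = l * x2 + c].
Proof.
move=> /eqP h1 /eqP h2 n12; exists (l ^+ 2 + a1 * l - a2 - x1 - x2).
have hy1 : y1 = l * x1 + c by rewrite /c addrC subrK.
have e6 : a6 = y1 ^+ 2 + a1 * x1 * y1 + a3 * y1 - (x1 ^+ 3 + a2 * x1 ^+ 2 + a4 * x1).
  by rewrite h1; ring.
suff [e4 hy2] : a4 = x1 * x2 + (x1 + x2) * (l ^+ 2 + a1 * l - a2 - x1 - x2)
      + 2%:R * l * c + a1 * c + a3 * l /\ y2 = l * x2 + c.
  by split=> //; split=> //; rewrite ?e6 e4 ?hy1; ring.
move: n12; rewrite /c {c hy1} /l {l} /slope; case: eqVneq => [e12|n12] /= n.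
  subst x2.
  have n0 : y1 + y2 + a1 * x1 + a3 != 0.
    apply: contra n => /eqP e; apply/eqP.
    by apply: (@addIr _ (y2 + a1 * x1 + a3)); rewrite !addrA e; ring.
  have e12 : y2 = y1.
    apply: (mulIf n0).
    have : (y2 - y1) * (y1 + y2 + a1 * x1 + a3) =
      (y2 ^+ 2 + a1 * x1 * y2 + a3 * y2) - (y1 ^+ 2 + a1 * x1 * y1 + a3 * y1).
      by ring.
    by rewrite h1 h2 subrr mulrBl => /eqP; rewrite subr_eq0 => /eqP.
  subst y2; have n1 : 2%:R * y1 + a1 * x1 + a3 != 0.
    by apply: contra n0 => /eqP e; rewrite -e; apply/eqP; ring.
  set d := 2%:R * _ + _ + _ in n1 *; set N := _ - a1 * y1.
  set l := N / d; have hl : l * d = N by rewrite /l mulfVK.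
  split; last by ring.
  have -> : a4 = l * d - 3%:R * x1 ^+ 2 - 2%:R * a2 * x1 + a1 * y1.
    by rewrite hl /N; ring.
  by rewrite /d; ring.
have n0 : x2 - x1 != 0 by rewrite subr_eq0 eq_sym.
set l := (y2 - y1) / (x2 - x1).
have hl : l * (x2 - x1) = y2 - y1 by rewrite /l mulfVK.
have hy2 : y2 = l * x2 + (y1 - l * x1) by rewrite -[y2](subrK y1) -hl; ring.
split=> //; apply: (mulIf n0); move: h2; rewrite e6 hy2 => h2.
apply/eqP; rewrite -subr_eq0; move/eqP: h2; rewrite -subr_eq0.
set u := (X in X == 0) => /eqP u0; rewrite -oppr_eq0 -u0; apply/eqP; rewrite /u.
ring.
Qed.

Hypothesis sm : smooth.
Implicit Types P Q R S T : ec_point W.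

Lemma ec_add0 P : ec_add P ec_zero = P.
Proof. by apply: val_inj; case: P => [[[x y]|] hP]. Qed.

Lemma ec_0add P : ec_add ec_zero P = P.
Proof. by apply: val_inj. Qed.

Lemma ec_oppK : involutive (@ec_opp F W).
Proof.
by move=> [[[x y]|] hP]; apply: val_inj => //=; congr (Some (_, _)); ring.
Qed.

Lemma ec_opp0 : ec_opp ec_zero = ec_zero :> ec_point W.
Proof. exact: val_inj. Qed.

Lemma ec_addN P : ec_add P (ec_opp P) = ec_zero.
Proof.
apply: val_inj; case: P => [[[x y]|] hP] //=; rewrite eqxx /=.
by rewrite ifT //; apply/eqP; ring.
Qed.

Lemma ec_addNl P : ec_add (ec_opp P) P = ec_zero.
Proof. by rewrite -{2}(ec_oppK P) ec_addN. Qed.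

(** One constructor covers chords and tangents, so that commutativity, opposites and cancellation
    become symmetries of [line_meets]. *)
Variant add_spec P Q : ec_point W -> Prop :=
| AddZero_l of P = ec_zero : add_spec P Q Q
| AddZero_r of Q = ec_zero : add_spec P Q P
| AddOpp of P = ec_opp Q : add_spec P Q ec_zero
| AddLine l c x1 x2 x3 R of line_meets l c x1 x2 x3
    & ec_val P = Some (x1, l * x1 + c) & ec_val Q = Some (x2, l * x2 + c)
    & ec_val R = Some (x3, l * x3 + c) : add_spec P Q (ec_opp R).

Lemma ec_addP P Q : add_spec P Q (ec_add P Q).
Proof.
case: P Q => [[[x1 y1]|] h1] [[[x2 y2]|] h2].
- set P := ECPoint h1; set Q := ECPoint h2.
  case e: ((x1 == x2) && (y1 == - y2 - a1 * x2 - a3)).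
    have -> : ec_add P Q = ec_zero by apply: val_inj; rewrite /= e.
    by apply: AddOpp; apply: val_inj; case/andP: e => /eqP /= -> /eqP ->.
  move/negbT: e => e; have [x3 [hm e1 e2]] := add_meets h1 h2 e.
  set l := slope _ _ _ _ _ in hm e1 e2; set c := _ - _ in hm e1 e2.
  have h3 : on_curve W (Some (x3, l * x3 + c)).
    exact: line_on_curve (line_meetsC (line_meetsCA hm)).
  have -> : ec_add P Q = ec_opp (ECPoint h3).
    by apply: val_inj; rewrite [LHS]/= [in LHS]e1 [in LHS]e2; exact: add_line.
  apply: (AddLine (x1 := x1) (x2 := x2) (x3 := x3) (l := l) (c := c)) => //=.
    by rewrite -e1.
  by rewrite -e2.
- have -> : ECPoint h2 = ec_zero by apply: val_inj.
  by rewrite ec_add0; apply: AddZero_r.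
- have -> : ECPoint h1 = ec_zero by apply: val_inj.
  by rewrite ec_0add; apply: AddZero_l.
have -> : ECPoint h1 = ec_zero by apply: val_inj.
by rewrite ec_0add; apply: AddZero_l.
Qed.

Lemma ec_add_line P Q R l c x1 x2 x3 : line_meets l c x1 x2 x3 ->
  ec_val P = Some (x1, l * x1 + c) -> ec_val Q = Some (x2, l * x2 + c) ->
  ec_val R = Some (x3, l * x3 + c) -> ec_add P Q = ec_opp R.
Proof.
by move=> hm eP eQ eR; apply: val_inj; rewrite /= eP eQ eR; exact: add_line.
Qed.

Lemma ec_addC P Q : ec_add P Q = ec_add Q P.
Proof.
case: (ec_addP P Q) => [->|->|->|l c x1 x2 x3 R hm eP eQ eR].
- by rewrite ec_add0.
- by rewrite ec_0add.
- by rewrite ec_addN.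
by rewrite (ec_add_line (line_meetsC hm) eQ eP eR).
Qed.

Lemma ec_oppD P Q : ec_opp (ec_add P Q) = ec_add (ec_opp P) (ec_opp Q).
Proof.
case: (ec_addP P Q) => [->|->|->|l c x1 x2 x3 R hm eP eQ eR].
- by rewrite ec_opp0 ec_0add.
- by rewrite ec_opp0 ec_add0.
- by rewrite ec_opp0 ec_addNl.
apply: esym; apply: (ec_add_line (line_meetsN hm)).
- by rewrite /= eP /=; congr (Some (_, _)); ring.
- by rewrite /= eQ /=; congr (Some (_, _)); ring.
- by rewrite /= eR /=; congr (Some (_, _)); ring.
Qed.

(** Cancellation comes before associativity: the line through P, Q and -(P + Q) is read with its
    last two points exchanged. *)
Lemma ec_addKl P Q : ec_add (ec_opp P) (ec_add P Q) = Q.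
Proof.
case: (ec_addP P Q) => [->|->|->|l c x1 x2 x3 R hm eP eQ eR].
- by rewrite ec_opp0 ec_0add.
- by rewrite ec_addNl.
- by rewrite ec_add0 ec_oppK.
rewrite -ec_oppD (ec_add_line (line_meetsCA hm) eP eR eQ).
exact: ec_oppK.
Qed.

Lemma same_abscissa P Q x y y' :
  ec_val P = Some (x, y) -> ec_val Q = Some (x, y') -> P = Q \/ P = ec_opp Q.
Proof.
move=> eP eQ; have := valP P; have := valP Q.
rewrite /= eP eQ => /eqP hQ /eqP hP.
have : (y - y') * (y - (- y' - a1 * x - a3)) = 0.
  by rewrite -[0](subrr (x ^+ 3 + a2 * x ^+ 2 + a4 * x + a6)) -{1}hP -hQ; ring.
move/eqP; rewrite mulf_eq0 !subr_eq0 => /orP[] /eqP e; [left|right];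
  by apply: val_inj; rewrite /= eP eQ e.
Qed.

(* With l, lam, m, mu the slopes of the chords P1P2, (P1+P2)P3, P2P3 and
   P1(P2+P3), one has l + lam = m + mu. *)
Lemma ec_addA_generic P Q : exists s : seq (ec_point W), forall T, T \notin s ->
  ec_add (ec_add P Q) T = ec_add P (ec_add Q T).
Proof.
(* Off this list, the remaining sums involving T are chords between distinct abscissas. The last two
   entries exclude Q + T = P and Q + T = -P, by cancellation. *)
exists [:: ec_zero; Q; ec_opp Q; ec_add P Q; ec_opp (ec_add P Q);
  ec_add (ec_opp Q) P; ec_add (ec_opp Q) (ec_opp P)] => T.
rewrite !inE !negb_or => /and5P[T0 /eqP TQ /eqP TNQ /eqP TPQ /and3P[/eqP TNPQ TP' TNP']].
case: (ec_addP P Q) TPQ TNPQ => [->|->|->|l c x1 x2 x4 S hm eP eQ eS] TPQ TNPQ.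
- by rewrite ec_0add.
- by rewrite ec_0add.
- by rewrite ec_0add ec_addKl.
have TP : ec_add Q T <> P by move=> e; case/eqP: TP'; rewrite -e ec_addKl.
have TNP : ec_add Q T <> ec_opp P.
  by move=> e; case/eqP: TNP'; rewrite -e ec_addKl.
case: (ec_addP Q T) TP TNP => [eQ0|eT0|eN|m d x2' x3 x5 R hm' eQ' eT eR] TP TNP.
- by rewrite eQ0 in eQ.
- by rewrite eT0 eqxx in T0.
- by case: TNQ; rewrite eN ec_oppK.
move: eQ'; rewrite eQ => -[e2 ey2]; subst x2'.
have n32 : x3 != x2.
  by apply/eqP => e; subst x3; case: (same_abscissa eT eQ).
have eNS : ec_val (ec_opp S) = Some (x4, - (l * x4 + c) - a1 * x4 - a3).
  by rewrite /= eS.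
have eNR : ec_val (ec_opp R) = Some (x5, - (m * x5 + d) - a1 * x5 - a3).
  by rewrite /= eR.
have n34 : x3 != x4.
  by apply/eqP => e; subst x4; case: (same_abscissa eT eNS).
have n51 : x5 != x1.
  by apply/eqP => e; subst x5; case: (same_abscissa eNR eP).
have [dE hd4 hd6] := hm'; have [e4 h4 h6] := hm.
have ed : d = l * x2 + c - m * x2 by rewrite ey2; ring.
have hT : m * x3 + d = (m - l) * (x3 - x2) + (l * x3 + c) by rewrite ed; ring.
(* The equation at T = (x3, y), compared with the first line, reads (x3 - x1)(x3 - x2)(x3 - x4) = (y
   - l x3 - c)(y + l x3 + c + a1 x3 + a3). The first factor on the right is (m - l)(x3 - x2), and x3
   - x2 is cancelled. *)
have key : (m - l) * ((l + a1) * (x3 - x4) + (m * x3 + d) -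
    (- (l * x4 + c) - a1 * x4 - a3)) = (x3 - x1) * (x3 - x4).
  have n0 : x3 - x2 != 0 by rewrite subr_eq0.
  apply: (mulIf n0).
  have := valP T; rewrite /= eT => /eqP; rewrite hT => h.
  have e2' : a2 = l ^+ 2 + a1 * l - x1 - x2 - x4 by rewrite e4; ring.
  move: h; rewrite h4 h6 e2' => /eqP; rewrite -subr_eq0 => /eqP h.
  apply/eqP; rewrite -subr_eq0 -h; apply/eqP; ring.
pose lam := (m * x3 + d - (- (l * x4 + c) - a1 * x4 - a3)) / (x3 - x4).
have n34' : x3 - x4 != 0 by rewrite subr_eq0.
have hlam : lam * (x3 - x4) = m * x3 + d - (- (l * x4 + c) - a1 * x4 - a3).
  by rewrite /lam mulfVK.
have key1 : (m - l) * (l + lam + a1) = x3 - x1.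
  apply: (mulIf n34'); rewrite -key.
  transitivity ((m - l) * ((l + a1) * (x3 - x4) + lam * (x3 - x4))); first ring.
  by rewrite hlam; ring.
(* Defined by the slope relation; [hmu] then identifies it as the slope of the chord through P and Q
   + T. *)
pose mu := l + lam - m.
have n51' : x5 - x1 != 0 by rewrite subr_eq0.
have e2' : a2 = l ^+ 2 + a1 * l - x1 - x2 - x4 by rewrite e4; ring.
have e3' : a3 = lam * (x3 - x4) - (m * x3 + d) - (l * x4 + c) - a1 * x4.
  by rewrite hlam; ring.
have e3 : x3 = x1 + (m - l) * (l + lam + a1) by rewrite key1; ring.
have hmu : mu * (x5 - x1) = - (m * x5 + d) - a1 * x5 - a3 - (l * x1 + c).
  by rewrite dE e3' e2' ed /mu e3; ring.
apply: val_inj; rewrite /= eS eR eT eP /=.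
rewrite [x4 == x3]eq_sym (negPf n34) [x1 == x5]eq_sym (negPf n51) /=.
rewrite /slope [x4 == x3]eq_sym (negPf n34) [x1 == x5]eq_sym (negPf n51).
rewrite -hlam -hmu !mulfK //.
have ex : lam ^+ 2 + a1 * lam - a2 - x4 - x3 = mu ^+ 2 + a1 * mu - a2 - x1 - x5.
  by rewrite dE e2' /mu e3; ring.
rewrite ex; congr (Some (_, _)); congr (- _ - _ - _).
by rewrite e3' dE e2' ed /mu e3; ring.
Qed.

Hypothesis many_points : forall s : seq (ec_point W), exists T, T \notin s.

Lemma ec_addIr T P Q : ec_add P T = ec_add Q T -> P = Q.
Proof. by rewrite !(ec_addC _ T) => e; rewrite -(ec_addKl T P) e ec_addKl. Qed.

(* Generic associativity is applied with a fourth point T in general position,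
   which is cancelled at the end. *)
Lemma ec_addA : associative (@ec_add F W).
Proof.
move=> P Q R.
have [s1 h1] := ec_addA_generic (ec_add P Q) R.
have [s2 h2] := ec_addA_generic P Q.
have [s3 h3] := ec_addA_generic Q R.
have [s4 h4] := ec_addA_generic P (ec_add Q R).
(* The second list is translated by -R because [h2] is applied to the point R + T. *)
pose s := s1 ++ [seq ec_add (ec_opp R) U | U <- s2] ++ s3 ++ s4.
have [T] := many_points s; rewrite !mem_cat !negb_or => /and4P[T1 T2 T3 T4].
apply: (@ec_addIr T).
rewrite (h4 _ T4) (h3 _ T3) (h1 _ T1) h2 //.
by apply: contra T2 => /(map_f (ec_add (ec_opp R))); rewrite ec_addKl.
Qed.
End GroupLaw.

(** * Infinitely many points over an algebraically closed field of characteristic zero *)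

Section PointsOverClosedField.
Variables (C : numClosedFieldType) (W : weierstrass C).

Definition ordinate (x : C) : C :=
  let b := wa1 W * x + wa3 W in
  (sqrtC (b ^+ 2 + 4%:R * (x ^+ 3 + wa2 W * x ^+ 2 + wa4 W * x + wa6 W)) - b) / 2%:R.

Lemma ordinateP x : on_curve W (Some (x, ordinate x)).
Proof.
rewrite /on_curve /ordinate; set b := _ + wa3 W.
set r := _ + wa6 W; set D := _ + _ * r; set q := sqrtC D.
have hq : q ^+ 2 = D by exact: sqrtCK.
apply/eqP; rewrite -addrA -mulrDl -/b.
have -> : r = (q ^+ 2 - b ^+ 2) / 4%:R by rewrite hq /D; field.
by field.
Qed.

Lemma many_points (s : seq (ec_point W)) : exists T, T \notin s.
Proof.
pose f n := ECPoint (ordinateP n%:R).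
have f_inj : injective f by move=> m n [] /eqP; rewrite eqr_nat => /eqP.
pose t := [seq f n | n <- iota 0 (size s).+1].
have /allPn[T _ Ts] : ~~ all (mem s) t; last by exists T.
apply/negP => /allP ts; have ut : uniq t by rewrite map_inj_uniq ?iota_uniq.
by have := uniq_leq_size ut ts; rewrite size_map size_iota ltnn.
Qed.
End PointsOverClosedField.

(** * The curve E *)

(** At a singular point y = -x/2, and x is a common root of 4x^3 + 5x^2 - 8x and of half its
    derivative. A Bezout combination of these two polynomials is the constant 16 times 153, 153
    being the discriminant of 4x^2 + 5x - 8. *)
Lemma smoothE (C : numClosedFieldType) : smooth (E C).
Proof.
move=> x y /eqP /= h /= d0 d1.
have ey : y = - x / 2%:R.
  have -> : y = (2%:R * y + 1 * x + 0) / 2%:R - x / 2%:R by field.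
  by rewrite d0; field.
have f0 : 4%:R * x ^+ 3 + 5%:R * x ^+ 2 - 8%:R * x = 0.
  move/eqP: h; rewrite -subr_eq0 ey => /eqP h.
  by rewrite -[RHS](mulr0 (- 4%:R)) -h; field.
have g0 : 6%:R * x ^+ 2 + 5%:R * x - 4%:R = 0.
  by rewrite -[RHS](mulr0 2%:R) -d1 ey; field.
have : 16%:R * 153%:R = 0 :> C.
  rewrite -[RHS](mulr0 (- 725%:R - 726%:R * x)) -f0 -[RHS]addr0.
  by rewrite -(mulr0 (484%:R * x ^+ 2 + 685%:R * x - 612%:R)) -g0; ring.
by move/eqP; rewrite mulf_eq0 !pnatr_eq0.
Qed.

(** Same elimination, for the polynomial (4x + 5)(x^2 + 8). *)
Lemma smoothE' (C : numClosedFieldType) : smooth (E' C).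
Proof.
move=> x y /eqP /= h /= d0 d1.
have ey : y = - x / 2%:R.
  have -> : y = (2%:R * y + 1 * x + 0) / 2%:R - x / 2%:R by field.
  by rewrite d0; field.
have f0 : 4%:R * x ^+ 3 + 5%:R * x ^+ 2 + 32%:R * x + 40%:R = 0.
  move/eqP: h; rewrite -subr_eq0 ey => /eqP h.
  by rewrite -[RHS](mulr0 (- 4%:R)) -h; field.
have g0 : 6%:R * x ^+ 2 + 5%:R * x + 16%:R = 0.
  by rewrite -[RHS](mulr0 2%:R) -d1 ey; field.
have : 8%:R * 81%:R * 289%:R = 0 :> C.
  rewrite -[RHS](mulr0 (2045%:R - 2154%:R * x)) -f0 -[RHS]addr0.
  by rewrite -(mulr0 (1436%:R * x ^+ 2 - 765%:R * x + 6592%:R)) -g0; ring.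
by move/eqP; rewrite !mulf_eq0 !pnatr_eq0.
Qed.

(** From here on, multiples on E use the notations of abelian groups; on E' they keep [ec_add] and
    [ec_mul]. *)
HB.instance Definition _ (C : numClosedFieldType) :=
  GRing.isZmodule.Build (ec_point (E C))
    (ec_addA (@smoothE C) (@many_points C (E C))) (ec_addC (@smoothE C))
    (@ec_0add _ _) (@ec_addNl _ _).

Section CurveE.
Variable C : numClosedFieldType.
Implicit Types P Q R T : ec_point (E C).

Lemma ec_mulE n P : ec_mul n P = P *+ n.
Proof. by elim: n => //= n IH; rewrite mulrS -IH. Qed.

Lemma ec_mulzE n P : ec_mulz n P = P *~ n.
Proof.
by case: n => n; rewrite /ec_mulz ec_mulE // NegzE mulrNz.
Qed.

(* Completing the square: with Y = y + x / 2 the curve is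
   Y^2 = x^3 + 5/4 x^2 - 2 x. *)
Definition pX P : C := if ec_val P is Some (x, y) then x else 0.
Definition pY P : C := if ec_val P is Some (x, y) then y + x / 2%:R else 0.
Definition cubic (x : C) := x ^+ 3 + 5%:R / 4%:R * x ^+ 2 - 2%:R * x.

Lemma ec_valE P : P != 0 -> ec_val P = Some (pX P, pY P - pX P / 2%:R).
Proof.
case: P => [[[x y]|] h] n; last by case/eqP: n; exact: val_inj.
by rewrite /pX /pY /= addrK.
Qed.

Lemma eqPt P Q : P != 0 -> Q != 0 -> pX P = pX Q -> pY P = pY Q -> P = Q.
Proof. by move=> /ec_valE eP /ec_valE eQ eX eY; apply: val_inj; rewrite /= eP eQ eX eY. Qed.

Lemma pY2 P : pY P ^+ 2 = cubic (pX P).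
Proof.
have := valP P; rewrite /= /pX /pY /cubic.
(* At infinity both coordinates have the default value 0, and [cubic] vanishes at 0. *)
case: (ec_val P) => [[x y] /eqP /=|_]; last by ring.
rewrite mul1r mul0r addr0 => h.
have -> : (y + x / 2%:R) ^+ 2 = (y ^+ 2 + x * y) + x ^+ 2 / 4%:R by field.
by rewrite h /=; field.
Qed.

Lemma pXN P : pX (- P) = pX P.
Proof. by case: P => [[[x y]|] h]. Qed.

Lemma pYN P : pY (- P) = - pY P.
Proof.
by case: P => [[[x y]|] h]; rewrite /pY /= ?oppr0 //; field.
Qed.

Lemma pX_inj P Q : P != 0 -> Q != 0 -> pX P = pX Q -> P = Q \/ P = - Q.
Proof.
move=> /ec_valE eP /ec_valE eQ e; rewrite e in eP.
exact: same_abscissa eP eQ.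
Qed.

Lemma pY_eq0 P : P != 0 -> (pY P == 0) = (P *+ 2 == 0).
Proof.
move=> P0; rewrite mulr2n addr_eq0; apply/eqP/eqP => h.
  by apply: eqPt; rewrite ?oppr_eq0 ?pXN ?pYN // h oppr0.
have /eqP : pY P + pY P = 0 by rewrite {1}h pYN addNr.
by rewrite -mulr2n mulrn_eq0 => /eqP.
Qed.

Lemma addX P Q (l := (pY Q - pY P) / (pX Q - pX P)) : P != 0 -> Q != 0 ->
  pX P != pX Q -> [/\ P + Q != 0, pX (P + Q) = l ^+ 2 - 5%:R / 4%:R - pX P - pX Q
  & pY (P + Q) = - (l * (pX (P + Q) - pX P) + pY P)].
Proof.
move=> P0 Q0 n.
suff e : ec_val (P + Q) = let x := l ^+ 2 - 5%:R / 4%:R - pX P - pX Q in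
    Some (x, - (l * (x - pX P) + pY P) - x / 2%:R).
  split; last 2 first.
  - by rewrite /pX e.
  - by rewrite /pY /pX e /= subrK.
  by apply/eqP => z; rewrite z in e.
have n0 : pX Q - pX P != 0 by rewrite subr_eq0 eq_sym.
rewrite /= (ec_valE P0) (ec_valE Q0) /= /slope (negPf n) /=.
have -> : (pY Q - pX Q / 2%:R - (pY P - pX P / 2%:R)) / (pX Q - pX P) = l - 1 / 2%:R.
  by rewrite /l; field.
by congr (Some (_, _)); field.
Qed.

Lemma dblX P (m := (3%:R * pX P ^+ 2 + 5%:R / 2%:R * pX P - 2%:R) / (2%:R * pY P)) :
  P != 0 -> P *+ 2 != 0 -> pX (P *+ 2) = m ^+ 2 - 5%:R / 4%:R - 2%:R * pX P
  /\ pY (P *+ 2) = - (m * (pX (P *+ 2) - pX P) + pY P).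
Proof.
move=> P0; rewrite -pY_eq0 // mulr2n => n0.
suff e : ec_val (P + P) = let x := m ^+ 2 - 5%:R / 4%:R - 2%:R * pX P in
    Some (x, - (m * (x - pX P) + pY P) - x / 2%:R).
  by rewrite /pX /pY e /= subrK.
rewrite /= (ec_valE P0) /= /slope eqxx /= ifF.
  have -> : (3%:R * pX P ^+ 2 + 2%:R * 1 * pX P + - 2%:R - 1 * (pY P - pX P / 2%:R)) /
   (2%:R * (pY P - pX P / 2%:R) + 1 * pX P + 0) = m - 1 / 2%:R.
    have -> : 2%:R * (pY P - pX P / 2%:R) + 1 * pX P + 0 = 2%:R * pY P by field.
    by rewrite /m; field.
  by congr (Some (_, _)); field.
apply/eqP => h; case/eqP: n0; apply: (mulfI (x := 2%:R)); first by rewrite pnatr_eq0.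
by move/eqP: h; rewrite -subr_eq0 => /eqP h; rewrite mulr0 -h; field.
Qed.
End CurveE.

(** * Halving *)

(** Here abscissas are measured from e1: the curve is Y^2 = X^3 - s X^2 + v X, cut by the line Y = l
    X + c at a1, a2, a3. Then [g] is the half-function of the root 0 and [h] the product of those of
    the other two roots; [y3] has the sign of the sum, not of the third intersection. *)
Lemma halving_addition_identity (F : numFieldType) (l c a1 a2 a3 : F)
  (s := a1 + a2 + a3 - l ^+ 2) (v := a1 * a2 + a1 * a3 + a2 * a3 + 2%:R * l * c)
  (y1 := l * a1 + c) (y2 := l * a2 + c) (y3 := - (l * a3 + c))
  (g := fun a y : F => (a ^+ 2 - v) / (2%:R * y))
  (h := fun a y : F => ((a ^+ 2 + v) ^+ 2 - 2%:R * s * a * (a ^+ 2 + v)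
                    + 4%:R * v * a ^+ 2) / (4%:R * y ^+ 2)) :
  c ^+ 2 = a1 * a2 * a3 -> y1 != 0 -> y2 != 0 -> y3 != 0 ->
  g a3 y3 * (g a2 y2 ^+ 2 - g a1 y1 ^+ 2) = g a1 y1 * h a2 y2 - g a2 y2 * h a1 y1.
Proof.
move=> hc n1 n2 n3; rewrite /g /h /s /v /y1 /y2 /y3 in n1 n2 n3 *.
by rewrite oppr_eq0 in n3; field: hc; rewrite n1 n2 ?oppr_eq0 n3.
Qed.

Section Halving.
Variable C : numClosedFieldType.
Implicit Types P Q R T : ec_point (E C).

Definition roots (e1 e2 e3 : C) : Prop :=
  [/\ e1 + e2 + e3 = - (5%:R / 4%:R), e1 * e2 + e1 * e3 + e2 * e3 = - 2%:R
    & e1 * e2 * e3 = 0].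

Lemma roots_rot e1 e2 e3 : roots e1 e2 e3 -> roots e2 e3 e1.
Proof. by case=> h1 h2 h3; split; rewrite -?h1 -?h2 -?h3; ring. Qed.

Lemma roots_swap e1 e2 e3 : roots e1 e2 e3 -> roots e2 e1 e3.
Proof. by case=> h1 h2 h3; split; rewrite -?h1 -?h2 -?h3; ring. Qed.

Lemma rootsE e1 e2 e3 : roots e1 e2 e3 ->
  [/\ 5%:R / 4%:R = - (e1 + e2 + e3), 2%:R = - (e1 * e2 + e1 * e3 + e2 * e3)
    & forall x, cubic x = (x - e1) * (x - e2) * (x - e3)].
Proof.
case=> h1 h2 h3; split; rewrite ?h1 ?h2 ?opprK // => x.
rewrite /cubic -[5%:R / _]opprK -h1.
have -> : 2%:R = - (e1 * e2 + e1 * e3 + e2 * e3) by rewrite h2 opprK.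
by rewrite -[LHS]subr0 -h3; ring.
Qed.

(* For e the abscissa of a 2-torsion point, a square root, rational in the
   coordinates of P, of pX (2 P) - e. *)
Definition sqr_half (e : C) P : C :=
  (pX P ^+ 2 - 2%:R * e * pX P - 2%:R * e ^+ 2 - 5%:R / 2%:R * e + 2%:R)
    / (2%:R * pY P).

Lemma sqr_halfE e1 e2 e3 P : roots e1 e2 e3 -> sqr_half e1 P =
  ((pX P - e1) ^+ 2 - (e1 - e2) * (e1 - e3)) / (2%:R * pY P).
Proof.
move=> /rootsE[h1 h2 h3]; rewrite /sqr_half; congr (_ / _).
have -> : 5%:R / 2%:R = 2%:R * (5%:R / 4%:R) :> C by field.
rewrite h1 [X in _ + X]h2; ring.
Qed.

Lemma sqr_halfN e P : sqr_half e (- P) = - sqr_half e P.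
Proof. by rewrite /sqr_half pXN pYN mulrN invrN mulrN. Qed.

(** The formulas of 2-descent: three square roots of x(2P) - e_i, with product Y(2P), determine P.
    The last two items are the recipe followed in [divisible2]. *)
Lemma halving e1 e2 e3 P (r := fun e => sqr_half e P) :
  roots e1 e2 e3 -> P != 0 -> P *+ 2 != 0 ->
  [/\ r e1 ^+ 2 = pX (P *+ 2) - e1, r e1 * r e2 * r e3 = pY (P *+ 2),
      pX P = pX (P *+ 2) + r e1 * r e2 + r e1 * r e3 + r e2 * r e3
    & pY P = (r e1 + r e2) * (r e1 + r e3) * (r e2 + r e3)].
Proof.
move=> h P0 P2; have [hX hY] := dblX P0 P2; rewrite -pY_eq0 // in P2.
rewrite /r hY hX (sqr_halfE P h) (sqr_halfE P (roots_rot h)).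
rewrite (sqr_halfE P (roots_rot (roots_rot h))).
have h5 : 5%:R / 2%:R = 2%:R * (5%:R / 4%:R) :> C by field.
have [h1 h2 h3] := rootsE h.
have := pY2 P; rewrite h3 h5 h1.
have -> : (3%:R * pX P ^+ 2 + 2%:R * - (e1 + e2 + e3) * pX P - 2%:R) =
  (pX P - e1) * (pX P - e2) + (pX P - e1) * (pX P - e3) + (pX P - e2) * (pX P - e3).
  by rewrite [X in _ - X]h2; ring.
move: (pX P) (pY P) P2 => x y P2 hy.
by split; field: hy.
Qed.

(** Taking e1 as origin of the abscissas reduces this to [halving_addition_identity]. *)
Lemma sqr_half_add e1 e2 e3 P Q (r := sqr_half) : roots e1 e2 e3 ->
  P != 0 -> Q != 0 -> P *+ 2 != 0 -> Q *+ 2 != 0 -> (P + Q) *+ 2 != 0 ->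
  pX P != pX Q ->
  r e1 (P + Q) * (r e1 Q ^+ 2 - r e1 P ^+ 2) =
  r e1 P * (r e2 Q * r e3 Q) - r e1 Q * (r e2 P * r e3 P).
Proof.
move=> h P0 Q0 P2 Q2 S2 n12.
have [S0 eX eY] := addX P0 Q0 n12.
move: eX eY; set l := (pY Q - pY P) / _ => eX eY.
have n0 : pX Q - pX P != 0 by rewrite subr_eq0 eq_sym.
have hl : l * (pX Q - pX P) = pY Q - pY P by rewrite /l mulfVK.
rewrite -!pY_eq0 // in P2 Q2 S2.
have [h5 _ hf] := rootsE h.
rewrite {}/r (sqr_halfE P h) (sqr_halfE Q h) (sqr_halfE (P + Q) h).
rewrite !(sqr_halfE _ (roots_rot h)) !(sqr_halfE _ (roots_rot (roots_rot h))).
have := pY2 Q; have := pY2 P; rewrite !hf => hP hQ.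
pose a1 := pX P - e1; pose a2 := pX Q - e1; pose a3 := pX (P + Q) - e1.
pose c := pY P - l * a1.
have y1 : pY P = l * a1 + c by rewrite /c; ring.
have y2 : pY Q = l * a2 + c.
  by rewrite -[pY Q](subrK (pY P)) -hl y1 /a1 /a2; ring.
have y3 : pY (P + Q) = - (l * a3 + c) by rewrite eY y1 /a3 /a1; ring.
have e3E : e3 = a1 + a2 + a3 - l ^+ 2 + 2%:R * e1 - e2.
  by rewrite /a3 eX h5 /a1 /a2; ring.
(* V X + K is the shifted cubic minus the square of the line minus (X - a1)(X - a2)(X - a3), the
   terms in X^2 cancelling by [e3E]. It vanishes at a1 and at a2, which differ, so V = K = 0. *)
pose V := (e1 - e2) * (e1 - e3) - (a1 * a2 + a1 * a3 + a2 * a3) - 2%:R * l * c.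
pose K := a1 * a2 * a3 - c ^+ 2.
have xE x : x = x - e1 + e1 by rewrite subrK.
have k1 : V * a1 + K = 0.
  move/eqP: hP; rewrite -subr_eq0 y1 => /eqP hP; rewrite -oppr0 -{}hP.
  by rewrite [pX P]xE -/a1 /V /K e3E; ring.
have k2 : V * a2 + K = 0.
  move/eqP: hQ; rewrite -subr_eq0 y2 => /eqP hQ; rewrite -oppr0 -{}hQ.
  by rewrite [pX Q]xE -/a2 /V /K e3E; ring.
have V0 : V = 0.
  have n : a2 - a1 != 0 by rewrite (_ : a2 - a1 = pX Q - pX P) // /a2 /a1; ring.
  by apply: (mulIf n); rewrite mul0r mulrBr -[V * a2](addrK K) k2 -[V * a1](addrK K) k1 subrr.
have hc : c ^+ 2 = a1 * a2 * a3.
  by apply/esym/eqP; rewrite -subr_eq0 -/K -k1 V0 mul0r add0r.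
have hv : (e1 - e2) * (e1 - e3) = a1 * a2 + a1 * a3 + a2 * a3 + 2%:R * l * c.
  by rewrite -[RHS]add0r -V0 /V; ring.
have eh a y : ((a + e1 - e2) ^+ 2 - (e2 - e3) * (e2 - e1)) / (2%:R * y)
   * (((a + e1 - e3) ^+ 2 - (e3 - e1) * (e3 - e2)) / (2%:R * y)) =
  ((a ^+ 2 + (e1 - e2) * (e1 - e3)) ^+ 2 - 2%:R * (e2 + e3 - 2%:R * e1) * a *
     (a ^+ 2 + (e1 - e2) * (e1 - e3)) + 4%:R * ((e1 - e2) * (e1 - e3)) * a ^+ 2)
   / (4%:R * y ^+ 2).
  rewrite mulf_div; congr (_ / _); ring.
have f1 e : pX P - e = a1 + e1 - e by rewrite /a1 subrK.
have f2 e : pX Q - e = a2 + e1 - e by rewrite /a2 subrK.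
rewrite (f1 e2) (f1 e3) (f2 e2) (f2 e3) -/a1 -/a2 -/a3.
rewrite !eh hv y1 y2 y3.
have -> : e2 + e3 - 2%:R * e1 = a1 + a2 + a3 - l ^+ 2 by rewrite e3E; ring.
by apply: halving_addition_identity; rewrite -?y1 -?y2 -?y3.
Qed.
End Halving.

(** * A square root of 2 from a basis of the 8-torsion *)

Section EightTorsion.
Variable C : numClosedFieldType.
Implicit Types A B P Q R T : ec_point (E C).

(** Translation by T is the involution of the last item on abscissas, and it multiplies Y by an
    explicit rational function of X. The three signs are the Weil pairings of T with the points of
    order 2. *)
Lemma sqr_half_transl e1 e2 e3 P T : roots e1 e2 e3 ->
  T != 0 -> T *+ 2 = 0 -> pX T = e1 -> P != 0 -> P *+ 2 != 0 ->
  [/\ sqr_half e1 (P + T) = sqr_half e1 P,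
      sqr_half e2 (P + T) = - sqr_half e2 P,
      sqr_half e3 (P + T) = - sqr_half e3 P
    & pX (P + T) - e1 = (e1 - e2) * (e1 - e3) / (pX P - e1)].
Proof.
move=> h T0 T2 eT P0 P2.
have S2 : (P + T) *+ 2 != 0 by rewrite mulrnDl T2 addr0.
have /eqP YT : pY T == 0 by rewrite pY_eq0 // T2.
have [h5 _ hf] := rootsE h; have hP := pY2 P; rewrite hf in hP.
have YP : pY P != 0 by rewrite pY_eq0.
have n1 : pX P - e1 != 0.
  by apply: contra YP => /eqP e; rewrite -sqrf_eq0 hP e !mul0r.
have n12 : pX P != pX T by rewrite eT -subr_eq0.
have [S0 eX eY] := addX P0 T0 n12.
have YS : pY (P + T) != 0 by rewrite pY_eq0.
have n1' : e1 - pX P != 0 by rewrite -opprB oppr_eq0.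
have {}eX : pX (P + T) = e1 + (e1 - e2) * (e1 - e3) / (pX P - e1).
  rewrite eX eT YT h5 sub0r.
  have -> : (- pY P / (e1 - pX P)) ^+ 2 = pY P ^+ 2 / (pX P - e1) ^+ 2.
    by field; rewrite n1.
  by rewrite hP; field.
have {}eY : pY (P + T) = - pY P * ((e1 - e2) * (e1 - e3)) / (pX P - e1) ^+ 2.
  by rewrite eY eX eT YT; field; rewrite n1.
have d0 : (e1 - e2) * (e1 - e3) != 0.
  by apply: contra YS => /eqP e; rewrite eY e mulr0 mul0r.
move: d0; rewrite mulf_eq0 negb_or => /andP[d2 d3].
rewrite !(sqr_halfE _ h) !(sqr_halfE _ (roots_rot h)) !(sqr_halfE _ (roots_rot (roots_rot h))).
rewrite eX eY; split; last by rewrite addrC addKr.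
all: by field; rewrite n1 YP d2 d3.
Qed.

(** [halving] applied to 2P and then to P; q e1 vanishes because its square is x(4P) - e1. *)
Lemma quarter e1 e2 e3 P (r := fun e => sqr_half e P)
  (q := fun e => sqr_half e (P *+ 2)) : roots e1 e2 e3 ->
  P *+ 4 != 0 -> P *+ 8 = 0 -> pX (P *+ 4) = e1 ->
  [/\ q e1 = 0, q e2 ^+ 2 = e1 - e2, q e3 ^+ 2 = e1 - e3
    & pX (P *+ 2) = e1 + q e2 * q e3] /\
  [/\ r e1 ^+ 2 = q e2 * q e3, r e2 ^+ 2 = q e2 * (q e2 + q e3),
      r e3 ^+ 2 = q e3 * (q e2 + q e3)
    & r e1 * r e2 * r e3 = q e2 * q e3 * (q e2 + q e3)].
Proof.
move=> h n4 e8 eX.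
have n2 : P *+ 2 != 0 by apply: contra n4 => /eqP e; rewrite (mulrnA P 2 2) e mul0rn.
have n0 : P != 0 by apply: contra n2 => /eqP ->; rewrite mul0rn.
have n4' : P *+ 2 *+ 2 != 0 by rewrite -mulrnA.
have [f1 f2 f3 f4] := halving h n2 n4'.
have [f1' _ _ _] := halving (roots_rot h) n2 n4'.
have [f1'' _ _ _] := halving (roots_rot (roots_rot h)) n2 n4'.
rewrite -mulrnA eX in f1 f1' f1'' f3.
have q1 : q e1 = 0 by apply/eqP; rewrite -sqrf_eq0 f1 subrr.
rewrite -/(q _) in f1 f1' f1'' f2 f3 f4; rewrite -/(q _) -/(q _) in f2 f3 f4.
rewrite -/(q e3) q1 !mul0r !addr0 in f3; rewrite -/(q e3) q1 !add0r in f4.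
have [g1 g2 _ _] := halving h n0 n2.
have [g1' _ _ _] := halving (roots_rot h) n0 n2.
have [g1'' _ _ _] := halving (roots_rot (roots_rot h)) n0 n2.
split; first by [].
split.
- by rewrite /r g1 f3; ring.
- by rewrite /r g1' f3 mulrDr -expr2 f1'; ring.
- by rewrite /r g1'' f3 mulrDr -expr2 f1''; ring.
by rewrite /r g2 f4.
Qed.

Lemma on_curve00 : on_curve (E C) (Some (0, 0)).
Proof. by rewrite /on_curve /=; apply/eqP; ring. Qed.

Definition T0 : ec_point (E C) := ECPoint on_curve00.

Lemma T0_neq0 : T0 != 0. Proof. by []. Qed.

Lemma T0X : pX T0 = 0. Proof. by []. Qed.

Lemma T0_2 : T0 *+ 2 = 0.
Proof. by apply/eqP; rewrite -pY_eq0 // /pY /= mul0r addr0. Qed.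

(** Independence of A and B is expressed on their multiples by 4, which are two distinct points of
    order 2. *)
Definition basis8 A B : Prop :=
  [/\ A *+ 8 = 0, A *+ 4 != 0, A *+ 4 != T0 & B *+ 4 = T0].

(* For basis8 A B, the square root of 2 of the introduction; sqr_half 0 is the
   function attached to B *+ 4 = T0. *)
Definition root2 A B : C :=
  (pX (A *+ 2) - pX (B *+ 2)) * sqr_half (pX (A *+ 4)) (B *+ 2)
  / (sqr_half 0 (A *+ 2) * sqr_half 0 A * sqr_half (pX (A *+ 4)) B).

(* If e != 0 is the abscissa of a point of order 2, those of the other two such
   points are 0 and third_root e. *)
Definition third_root (e : C) : C := - (5%:R / 4%:R) - e.

(** Besides 0, the cubic has the roots of x^2 + (5/4) x - 2, whose sum is -5/4. *)
Lemma torsion2_roots T (e := pX T) : T != 0 -> T != T0 -> T *+ 2 = 0 ->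
  [/\ roots 0 e (third_root e), e != 0, third_root e != 0, e != third_root e
    & pX (T + T0) = third_root e].
Proof.
move=> n0 n1 e2.
have /eqP YT : pY T == 0 by rewrite pY_eq0 // e2.
have e0 : e != 0.
  by apply: contra n1 => /eqP e0; apply/eqP; apply: eqPt => //; rewrite YT /pY /= mul0r addr0.
have q : e ^+ 2 + 5%:R / 4%:R * e - 2%:R = 0.
  apply: (mulfI e0); rewrite mulr0; transitivity (cubic e).
    by rewrite /cubic; ring.
  by rewrite -pY2 YT expr0n.
have ef : e * third_root e = - 2%:R by rewrite /third_root -[RHS]subr0 -q; ring.
have rt : roots 0 e (third_root e).
  by split; [rewrite /third_root; ring | rewrite -ef; ring | rewrite !mul0r].
have f0 : third_root e != 0.
  apply/eqP => f0; rewrite f0 mulr0 in ef; move/eqP: ef.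
  by rewrite eq_sym oppr_eq0 pnatr_eq0.
split=> //.
  (* A double root would be -5/8, where the quadratic takes the value -153/64. *)
  apply/eqP => ee; have e5 : e = - (5%:R / 8%:R).
    by rewrite -[LHS](mulfK (_ : 2%:R != 0)) ?pnatr_eq0 // mulr_natr mulr2n {2}ee /third_root; field.
  have : 153%:R / 64%:R = 0 :> C by rewrite -oppr0 -q e5; field.
  by move/eqP; rewrite mulf_eq0 invr_eq0 !pnatr_eq0.
have nX : pX T != pX T0 by rewrite T0X.
have [_ -> _] := addX n0 T0_neq0 nX.
by rewrite YT T0X /pY /= mul0r addr0 subrr mul0r -/e /third_root; ring.
Qed.

End EightTorsion.
Arguments T0 {C}.

(** * Half-functions at the points of a basis, and the square of [root2] *)

Section BasisHalves.
Variable C : numClosedFieldType.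
Implicit Types A B P Q R T : ec_point (E C).

Lemma pX_neq n P Q : P != 0 -> Q != 0 -> pX (P *+ n) != pX (Q *+ n) ->
  pX P != pX Q.
Proof.
move=> P0 Q0; apply: contra => /eqP /(pX_inj P0 Q0) [] -> //.
by rewrite mulNrn pXN.
Qed.

Lemma mulrn_neq0 m n P : P *+ (m * n) != 0 -> P *+ m != 0.
Proof. by apply: contra => /eqP e; rewrite mulrnA e mul0rn. Qed.

(** The half-functions at 2A are [a] (root 0) and [b] (root e3); at 2B they are [d] (root e1) and
    [g] (root e3). At A and B the indices 1, 2, 3 stand for the roots e1, 0, e3, where e1 is the
    abscissa of 4A. *)
Record halves A B (e1 e3 a b g d a1 a2 a3 b1 b2 b3 : C) : Prop := Halves {
  hv_e3 : e3 = - g ^+ 2;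
  hv_d2 : d ^+ 2 = - a ^+ 2; hv_b2 : b ^+ 2 = a ^+ 2 + g ^+ 2;
  hv_x2A : pX (A *+ 2) = a ^+ 2 + a * b; hv_x2B : pX (B *+ 2) = d * g;
  hv_a2 : a2 ^+ 2 = a * (a + b);
  hv_a : a1 * a2 * a3 = a * b * (a + b);
  hv_b1 : b1 ^+ 2 = d * (d + g); hv_b2' : b2 ^+ 2 = d * g;
  hv_b3 : b3 ^+ 2 = g * (d + g);
  hv_b : b1 * b2 * b3 = d * g * (d + g);
  hv_n : [/\ a != 0, b != 0, g != 0 & d != 0];
  hv_n' : [/\ a2 != 0, b1 != 0 & b3 != 0] }.

Lemma basis8_neq0 A B : basis8 A B ->
  [/\ [/\ A != 0, A *+ 2 != 0 & A *+ 4 != 0],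
      [/\ B != 0, B *+ 2 != 0, B *+ 4 != 0 & B *+ 8 = 0],
      pX A != pX B, pX (A *+ 2) != pX (B *+ 2) & pX B != pX (A *+ 2)].
Proof.
case=> e8 n4 n4' eB.
have [_ e0 _ _ _] : [/\ _, _, _, _ & _] := torsion2_roots n4 n4' (etrans (esym (mulrnA A 4 2)) e8).
have A0 : A != 0 by apply: (@mulrn_neq0 1 4).
have A2 : A *+ 2 != 0 by apply: (@mulrn_neq0 2 2).
have B4 : B *+ 4 != 0 by rewrite eB.
have B0 : B != 0 by apply: (@mulrn_neq0 1 4).
have B2 : B *+ 2 != 0 by apply: (@mulrn_neq0 2 2).
split=> //.
- by split=> //; rewrite (mulrnA B 4 2) eB T0_2.
- by apply: (@pX_neq 4) => //; rewrite eB.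
- by apply: (@pX_neq 2) => //; rewrite -!mulrnA eB.
apply/eqP => /(pX_inj B0 A2) e.
have : B *+ 4 = 0 by case: e => ->; rewrite ?mulNrn -mulrnA e8 ?oppr0.
by apply/eqP.
Qed.

Lemma basis8_halves A B (e1 := pX (A *+ 4)) (e3 := third_root e1)
  (r := @sqr_half C) : basis8 A B ->
  halves A B e1 e3 (r 0 (A *+ 2)) (r e3 (A *+ 2)) (r e3 (B *+ 2)) (r e1 (B *+ 2))
    (r e1 A) (r 0 A) (r e3 A) (r e1 B) (r 0 B) (r e3 B).
Proof.
move=> hb; have [[A0 A2 A4] [B0 B2 B4 B8] _ _ _] := basis8_neq0 hb.
have [e8 n4 n4' eB] := hb.
have [rt n1 n3 n13 _] := torsion2_roots n4 n4' (etrans (esym (mulrnA A 4 2)) e8).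
have [[_ f2 f3 f4] [g1 g2 g3 g4]] := quarter (roots_swap rt) n4 e8 (erefl _).
have eBX : pX (B *+ 4) = 0 by rewrite eB.
have [[_ f2' f3' f4'] [g1' g2' g3' g4']] := quarter rt B4 B8 eBX.
rewrite -/e1 -/e3 in rt n1 n3 n13 f2 f3 f4 g1 g2 g3 g4 f2' f3' f4' g1' g2' g3' g4'.
rewrite -/r in f2 f3 f4 g1 g2 g3 g4 f2' f3' f4' g1' g2' g3' g4'.
rewrite subr0 in f2; rewrite !sub0r in f2' f3'; rewrite add0r in f4'.
have sq0 (x y : C) : y != 0 -> x ^+ 2 = y -> x != 0.
  by move=> y0 e; rewrite -sqrf_eq0 e.
set a := r 0 (A *+ 2) in f2 f4 g1 g2 g3 g4 *.
set b := r e3 (A *+ 2) in f3 f4 g1 g2 g3 g4 *.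
set g := r e3 (B *+ 2) in f3' f4' g1' g2' g3' g4' *.
set d := r e1 (B *+ 2) in f2' f4' g1' g2' g3' g4' *.
have a0 : a != 0 by apply: sq0 f2.
have b0 : b != 0 by apply: sq0 f3; rewrite subr_eq0.
have g0 : g != 0 by apply: sq0 f3'; rewrite oppr_eq0.
have d0 : d != 0 by apply: sq0 f2'; rewrite oppr_eq0.
have ab : a + b != 0.
  apply/eqP => /eqP; rewrite addr_eq0 => /eqP e.
  case/eqP: n3; apply: (subrI e1); rewrite subr0 -f3 -f2 e; ring.
have dg : d + g != 0.
  apply/eqP => /eqP; rewrite addr_eq0 => /eqP e.
  by case/eqP: n13; apply: oppr_inj; rewrite -f2' -f3' e; ring.
split=> //.
- by rewrite f3' opprK.
- by rewrite f2' f2.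
- by rewrite f3 f2 f3'.
- by rewrite f4 f2.
- by rewrite -g4'; ring.
split.
- by apply: sq0 g2; rewrite mulf_neq0.
- by apply: sq0 g2'; rewrite mulf_neq0.
by apply: sq0 g3'; rewrite mulf_neq0.
Qed.

(** In the notation of [halves], [root2] is (a^2 + ab - dg) d / (a a2 b1). Its square involves a2
    and b1 only through their squares, and the relations d^2 = -a^2 and b^2 = a^2 + g^2 reduce it to
    2. *)
Lemma root2_sqr A B : basis8 A B -> root2 A B ^+ 2 = 2%:R.
Proof.
move=> /basis8_halves[e3E d2 b2 xA xB qa2 qa qb1 qb2 qb3 qb
  [a0 b0 g0 d0] [a2 b1 b3]].
rewrite /root2 xA xB; move: (third_root _) d2 b2 qa2 qb1 a0 d0 a2 b1 => e3.
move: (pX (A *+ 4)) => e1.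
move: (sqr_half 0 (A *+ 2)) (sqr_half e3 (A *+ 2)) (sqr_half e3 (B *+ 2)).
move: (sqr_half e1 (B *+ 2)) (sqr_half 0 A) (sqr_half e1 B) => d s t a b g.
move=> d2 b2 hs ht a0 d0 s0 t0.
have : s ^+ 2 != 0 by rewrite sqrf_eq0.
have : t ^+ 2 != 0 by rewrite sqrf_eq0.
rewrite hs ht !mulf_eq0 !negb_or => /andP[_ n1] /andP[_ n2].
rewrite expr_div_n !exprMn hs ht.
by field: d2 b2; rewrite a0 d0 n1 n2.
Qed.
End BasisHalves.

(** * Effect on [root2] of elementary changes of basis *)

Section RootInvariance.
Variable C : numClosedFieldType.
Implicit Types A B P Q R T : ec_point (E C).

Lemma basis8_addl A B : basis8 A B -> basis8 (A + B) B.
Proof.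
move=> hb; have [_ [_ _ B4 B8] _ _ _] := basis8_neq0 hb.
case: hb => e8 n4 n4' eB; have T2 := T0_2 C.
split=> //; rewrite ?mulrnDl ?e8 ?B8 ?addr0 // eB.
  apply: contra n4' => /eqP e; rewrite -[_ *+ 4](addrK T0) e sub0r.
  by rewrite eq_sym -addr_eq0 -mulr2n T2.
by apply: contra n4 => /eqP e; rewrite -[_ *+ 4](addrK T0) e subrr.
Qed.

Lemma basis8_addr A B : basis8 A B -> basis8 A (B + A *+ 2).
Proof.
case=> e8 n4 n4' eB.
by split=> //; rewrite mulrnDl -mulrnA e8 addr0.
Qed.

(** [s] and [s2] are the half-functions of the root 0 at A + B and 2(A + B), [s1] that of e1 at 2(A
    + B); their equations are instances of [sqr_half_add]. As 4(A + B) has abscissa e3, [g] and [b3]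
    take the places of [d] and [b1]. *)
Lemma root2_addl_identity (F : numFieldType) (a b g d a1 a2 a3 b1 b2 b3 s s1 s2 : F) :
  d ^+ 2 = - a ^+ 2 -> b ^+ 2 = a ^+ 2 + g ^+ 2 ->
  a2 ^+ 2 = a * (a + b) -> a1 * a2 * a3 = a * b * (a + b) ->
  b1 ^+ 2 = d * (d + g) -> b2 ^+ 2 = d * g -> b3 ^+ 2 = g * (d + g) ->
  b1 * b2 * b3 = d * g * (d + g) ->
  a != 0 -> d != 0 -> a2 != 0 -> b1 != 0 -> b3 != 0 -> s2 != 0 -> s != 0 ->
  s2 * - a ^+ 2 = a * (d * g) -> s1 * d ^+ 2 = - (d * (a * b)) ->
  s * (b2 ^+ 2 - a2 ^+ 2) = a2 * (b1 * b3) - b2 * (a1 * a3) ->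
  (- g ^+ 2 + s2 * s1 - d * g) * g / (s2 * s * b3) =
  (a ^+ 2 + a * b - d * g) * d / (a * a2 * b1).
Proof.
move=> hd hb ha2 ha hb1 hb2 hb3 hbb a0 d0 a20 b10 b30 s20 s0 e2 e1 es.
have es2 : s2 = - (d * g) / a.
  apply: (mulIf (_ : - a ^+ 2 != 0)); first by rewrite oppr_eq0 sqrf_eq0.
  by rewrite e2; field.
have es1 : s1 = - (a * b) / d.
  apply: (mulIf (_ : d ^+ 2 != 0)); first by rewrite sqrf_eq0.
  by rewrite e1; field.
apply/eqP; rewrite eqr_div ?mulf_neq0 //; apply/eqP.
(* The extra factor a2 b1 completes the values at A and B into squares and the products a1 a2 a3 and
   b1 b2 b3, all of which are known. *)
apply: (mulIf (mulf_neq0 a20 b10)).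
have N : s * (a ^+ 2 + a * b - d * g) * b3 * (a2 * b1) =
    a * b * (a + b) * (d * g * (d + g)) - a * (a + b) * (d * (d + g)) * (g * (d + g)).
  rewrite -hbb -ha -hb3 -hb1 -ha2.
  have -> : a ^+ 2 + a * b - d * g = - (b2 ^+ 2 - a2 ^+ 2) by rewrite hb2 ha2; ring.
  by rewrite mulrN es; ring.
transitivity (d * s2 * (s * (a ^+ 2 + a * b - d * g) * b3 * (a2 * b1))); last by ring.
rewrite N.
transitivity ((- g ^+ 2 + s2 * s1 - d * g) * g * a * (a2 ^+ 2 * b1 ^+ 2)); first by ring.
by rewrite ha2 hb1 es1 es2; field: hd hb; rewrite a0 d0.
Qed.

Lemma root2_addl A B : basis8 A B -> root2 (A + B) B = root2 A B.
Proof.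
move=> hb; have hb' := basis8_addl hb.
have [[A0 A2 A4] [B0 B2 B4 B8] nAB n2 _] := basis8_neq0 hb.
have [[S0 S2 S4] _ _ _ _] := basis8_neq0 hb'.
have [e8 n4 n4' eB] := hb.
have [rt n1 n3 n13 e3X] := torsion2_roots n4 n4' (etrans (esym (mulrnA A 4 2)) e8).
have [[qA _ _ _] _] := quarter (roots_swap rt) n4 e8 (erefl _).
have eBX : pX (B *+ 4) = 0 by rewrite eB.
have [[qB _ _ _] _] := quarter rt B4 B8 eBX.
have S4X : pX ((A + B) *+ 4) = third_root (pX (A *+ 4)) by rewrite mulrnDl eB.
have [e8' _ _ _] := hb'.
have rt' := roots_rot (roots_rot rt).
have [[qS _ _ xS] _] := quarter rt' S4 e8' S4X.
have S4' : (A *+ 2 + B *+ 2) *+ 2 != 0 by rewrite -mulrnDl -mulrnA.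
have A4' : A *+ 2 *+ 2 != 0 by rewrite -mulrnA.
have B4' : B *+ 2 *+ 2 != 0 by rewrite -mulrnA.
have add2 := sqr_half_add rt A2 B2 A4' B4' S4' n2.
have add1 := sqr_half_add (roots_swap rt) A2 B2 A4' B4' S4' n2.
have add0 := sqr_half_add rt A0 B0 A2 B2 S2 nAB.
have [_ _ _ _ _ _ _ _ _ _ _ [a0' _ _ _] [s0 _ _]] := basis8_halves hb'.
have [e3E d2 b2 xA xB qa2 qa qb1 qb2 qb3 qb
  [a0 b0 g0 d0] [a2 b1 b3]] := basis8_halves hb.
rewrite qA qB in add2 add1.
rewrite /root2 S4X xS xA xB {1}e3E.
rewrite -mulrnDl expr0n /= sub0r !mul0r subr0 in add2.
rewrite -mulrnDl expr0n /= subr0 !mul0r sub0r in add1.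
exact: (root2_addl_identity (a1 := sqr_half (pX (A *+ 4)) A)
  (a3 := sqr_half (third_root (pX (A *+ 4))) A)
  (b2 := sqr_half 0 B)).
Qed.

(** 2B is translated by 4A, which keeps [d] and changes the sign of [g]; the addition formula turns
    [b1] into -ab / b1, since the half-function of e1 vanishes at 2A. *)
Lemma root2_addr A B : basis8 A B -> root2 A (B + A *+ 2) = root2 A B.
Proof.
move=> hb; have hb' := basis8_addr hb.
have [[A0 A2 A4] [B0 B2 B4 B8] _ _ n2] := basis8_neq0 hb.
have [_ [S0 S2 S4 _] _ _ _] := basis8_neq0 hb'.
have [e8 n4 n4' eB] := hb.
have A42 : A *+ 4 *+ 2 = 0 by rewrite -mulrnA.
have [rt n1 n3 n13 e3X] := torsion2_roots n4 n4' A42.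
have [[qA _ _ _] _] := quarter (roots_swap rt) n4 e8 (erefl _).
have A4' : A *+ 2 *+ 2 != 0 by rewrite -mulrnA.
have B4' : B *+ 2 *+ 2 != 0 by rewrite -mulrnA.
have add1 := sqr_half_add (roots_swap rt) B0 A2 B2 A4' S2 n2.
have [h1 _ h3 _] := sqr_half_transl (roots_swap rt) A4 A42 (erefl _) B2 B4'.
have eS : (B + A *+ 2) *+ 2 = B *+ 2 + A *+ 4 by rewrite mulrnDl -mulrnA.
have [_ _ _ _ xS _ _ _ _ _ _ _ [_ t0 _]] := basis8_halves hb'.
have [e3E d2 b2 xA xB qa2 qa qb1 qb2 qb3 qb
  [a0 b0 g0 d0] [a2 b1 b3]] := basis8_halves hb.
rewrite qA expr0n /= sub0r mul0r subr0 in add1.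
rewrite eS h1 h3 in xS.
rewrite /root2 eS xS xA xB h1.
move: (third_root _) d2 b2 qb1 a0 b0 g0 d0 a2 b1 add1 t0 {xA xB xS e3X qb qb2 qb3 h3 e3E b3 qa qa2 h1 qA rt n1 n3 n13} => e3.
move: (sqr_half 0 (A *+ 2)) (sqr_half e3 (A *+ 2)) (sqr_half e3 (B *+ 2)).
move: (sqr_half _ (B *+ 2)) (sqr_half 0 A) (sqr_half _ B) (sqr_half _ (B + _)).
move=> d s t t' a b g d2 b2 ht a0 b0 g0 d0 s0 t0 et t'0.
have -> : t' = - (a * b) / t.
  by apply: (mulIf (_ : - t ^+ 2 != 0)); [rewrite oppr_eq0 sqrf_eq0 | rewrite et; field].
apply/eqP; rewrite eqr_div ?mulf_neq0 ?invr_eq0 ?oppr_eq0 ?mulf_neq0 //; apply/eqP.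
apply: (mulIf t0).
transitivity ((a ^+ 2 + a * b + d * g) * d * a * s * t ^+ 2); first by ring.
by rewrite ht; field: d2 b2.
Qed.

Lemma root2_oppl A B : root2 (- A) B = root2 A B.
Proof. by rewrite /root2 !mulNrn !pXN !sqr_halfN mulrNN. Qed.

Lemma root2_oppr A B : root2 A (- B) = root2 A B.
Proof. by rewrite /root2 !mulNrn !pXN !sqr_halfN !mulrN invrN mulrNN. Qed.

(** 5A = A + 4A: translation by 4A changes the sign of the half-function of 0 at A, and the other
    factors only see 2A. *)
Lemma root2_mul5l A B : basis8 A B -> root2 (A *+ 5) B = - root2 A B.
Proof.
move=> hb; have [[A0 A2 A4] _ _ _ _] := basis8_neq0 hb.
have [e8 n4 n4' eB] := hb.
have A42 : A *+ 4 *+ 2 = 0 by rewrite -mulrnA.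
have [rt _ _ _ _] := torsion2_roots n4 n4' A42.
have [_ h _ _] := sqr_half_transl (roots_swap rt) A4 A42 (erefl _) A0 A2.
have mE m n : (m = n %[mod 8])%N -> A *+ m = A *+ n.
  move=> e; rewrite (divn_eq m 8) (divn_eq n 8) e !mulrnDr.
  by rewrite ![(_ * 8)%N]mulnC !mulrnA e8 !mul0rn.
rewrite /root2 -!mulrnA !(mE (5 * 2)%N 2%N) // !(mE (5 * 4)%N 4%N) //.
by rewrite (mulrS A 4) h mulrN mulNr invrN mulrN.
Qed.

(** 5B = B + [T0], which changes the sign of the half-function of e1 at B. *)
Lemma root2_mul5r A B : basis8 A B -> root2 A (B *+ 5) = - root2 A B.
Proof.
move=> hb; have [_ [B0 B2 B4 B8] _ _ _] := basis8_neq0 hb.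
have [e8 n4 n4' eB] := hb.
have [rt _ _ _ _] := torsion2_roots n4 n4' (etrans (esym (mulrnA A 4 2)) e8).
have [_ h _ _] := sqr_half_transl rt (T0_neq0 C) (T0_2 C) (T0X C) B0 B2.
have e10 : B *+ 5 *+ 2 = B *+ 2 by rewrite -mulrnA (mulrnDr B 8 2) B8 add0r.
rewrite /root2 e10 (mulrS B 4) eB h.
by rewrite mulrN invrN mulrN.
Qed.
End RootInvariance.

(** * General change of basis and the quadratic character of 2 *)

Section BasisChange.
Variable C : numClosedFieldType.
Implicit Types A B P Q R T : ec_point (E C).

Lemma mulrn_mod (V : zmodType) (p : nat) (x : V) m n :
  x *+ p = 0 -> (m = n %[mod p])%N -> x *+ m = x *+ n.
Proof.
move=> e8 e; rewrite (divn_eq m p) (divn_eq n p) e !mulrnDr.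
by rewrite ![(_ * p)%N]mulnC !mulrnA e8 !mul0rn.
Qed.

(** For odd n, the condition that the Jacobi symbol (2 / n) equals 1. *)
Definition pm1_mod8 (n : nat) : bool := (n %% 8 == 1)%N || (n %% 8 == 7)%N.

Lemma odd_mod8 n : odd n -> [\/ n %% 8 = 1, n %% 8 = 3, n %% 8 = 5 | n %% 8 = 7]%N.
Proof.
move=> on; have : odd (n %% 8) by rewrite odd_mod.
have : (n %% 8 < 8)%N by rewrite ltn_mod.
case: (n %% 8)%N => [|[|[|[|[|[|[|[|m]]]]]]]] //= _ _; by [constructor 1|constructor 2|constructor 3|constructor 4].
Qed.

Lemma pm1_mod8M m n : odd m -> odd n ->
  pm1_mod8 (m * n) = (pm1_mod8 m == pm1_mod8 n).
Proof.
rewrite /pm1_mod8 -modnMm => /odd_mod8[] -> /odd_mod8[] ->; by [].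
Qed.

Lemma odd_sqr_mod8 n : odd n -> (n * n = 1 %[mod 8])%N.
Proof. by move/odd_mod8 => h; rewrite -modnMm; case: h => ->. Qed.

Lemma basis8_mull A B a : odd a -> basis8 A B -> basis8 (A *+ a) B.
Proof.
move=> oa [e8 n4 n4' eB].
have e4 : A *+ a *+ 4 = A *+ 4.
  by rewrite -mulrnA; apply: (mulrn_mod e8); rewrite -modnMml; case: (odd_mod8 oa) => ->.
by split; rewrite ?e4 // -mulrnA mulnC mulrnA e8 mul0rn.
Qed.

Lemma basis8_mulr A B d : odd d -> basis8 A B -> basis8 A (B *+ d).
Proof.
move=> od hb; have [_ [_ _ _ B8] _ _ _] := basis8_neq0 hb.
case: hb => e8 n4 n4' eB; split=> //; rewrite -eB -mulrnA.
by apply: (mulrn_mod B8); rewrite -modnMml; case: (odd_mod8 od) => ->.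
Qed.

(** The units modulo 8 are generated by -1, which fixes [root2], and 5, which changes its sign. *)
Lemma root2_mull A B a : odd a -> basis8 A B ->
  root2 (A *+ a) B = (-1) ^+ (~~ pm1_mod8 a) * root2 A B.
Proof.
move=> oa hb; have [e8 _ _ _] := hb.
have eN m n : (m + n = 0 %[mod 8])%N -> A *+ m = - (A *+ n).
  by move=> e; apply/eqP; rewrite -addr_eq0 -mulrnDr (mulrn_mod e8 e).
rewrite -(mulrn_mod e8 (modn_mod a 8)) /pm1_mod8.
case: (odd_mod8 oa) => -> /=.
- by rewrite mulr1n mul1r.
- by rewrite (eN 3 5) // root2_oppl root2_mul5l // mulN1r.
- by rewrite root2_mul5l // mulN1r.
by rewrite (eN 7 1) // root2_oppl mul1r.
Qed.

Lemma root2_mulr A B d : odd d -> basis8 A B ->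
  root2 A (B *+ d) = (-1) ^+ (~~ pm1_mod8 d) * root2 A B.
Proof.
move=> od hb; have [_ [_ _ _ e8] _ _ _] := basis8_neq0 hb.
have eN m n : (m + n = 0 %[mod 8])%N -> B *+ m = - (B *+ n).
  by move=> e; apply/eqP; rewrite -addr_eq0 -mulrnDr (mulrn_mod e8 e).
rewrite -(mulrn_mod e8 (modn_mod d 8)) /pm1_mod8.
case: (odd_mod8 od) => -> /=.
- by rewrite mulr1n mul1r.
- by rewrite (eN 3 5) // root2_oppr root2_mul5r // mulN1r.
- by rewrite root2_mul5r // mulN1r.
by rewrite (eN 7 1) // root2_oppr mul1r.
Qed.

Lemma root2_addl_muln A B n : basis8 A B ->
  basis8 (A + B *+ n) B /\ root2 (A + B *+ n) B = root2 A B.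
Proof.
move=> hb; elim: n => [|n [h e]]; first by rewrite addr0.
by rewrite mulrSr addrA -e; split; [apply: basis8_addl | apply: root2_addl].
Qed.

Lemma root2_addr_muln A B n : basis8 A B ->
  basis8 A (B + A *+ (2 * n)) /\ root2 A (B + A *+ (2 * n)) = root2 A B.
Proof.
move=> hb; elim: n => [|n [h e]]; first by rewrite muln0 addr0.
rewrite mulnSr mulrnDr addrA -e.
by split; [apply: basis8_addr | apply: root2_addr].
Qed.

(** As a^2 = 1 modulo 8, the first vector is a (A + ab B); the second is d' B plus ca times the
    first, with d' = d - abc and c even. Hence only elementary changes occur, and a d' is the
    determinant modulo 8. The coefficient 7 stands for -1 in natural numbers. *)
Lemma root2_change_basis A B (a b c d : nat) :
  basis8 A B -> odd a -> ~~ odd c -> odd d ->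
  root2 (A *+ a + B *+ b) (A *+ c + B *+ d) =
  (-1) ^+ (~~ pm1_mod8 (a * d + 7 * (b * c))) * root2 A B.
Proof.
move=> hb oa oc od; have [_ [_ _ _ B8] _ _ _] := basis8_neq0 hb.
have [A8 _ _ _] := hb; have aa := odd_sqr_mod8 oa.
have aax x : (a * a * x = x %[mod 8])%N by rewrite -modnMml aa modnMml mul1n.
have [hb1 e1] := root2_addl_muln (a * b) hb.
set A1 := A + _ in hb1 e1.
have eA : A *+ a + B *+ b = A1 *+ a.
  rewrite /A1 mulrnDl -mulrnA; congr (_ + _); apply: (mulrn_mod B8).
  by rewrite -mulnA mulnC -mulnA mulnC aax.
have hb2 := basis8_mull oa hb1.
pose d' := (d + 7 * (a * b * c))%N.
have od' : odd d' by rewrite /d' oddD od !oddM (negbTE oc) !andbF.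
have hb3 := basis8_mulr od' hb2.
have [_ e4] := root2_addr_muln (c./2 * a) hb3.
have eB : A *+ c + B *+ d = B *+ d' + A1 *+ a *+ (2 * (c./2 * a)).
  rewrite -eA mulnA mul2n even_halfK // mulrnDl -!mulrnA addrCA -mulrnDr.
  congr (_ + _).
    by apply: (mulrn_mod A8); rewrite mulnCA mulnC -mulnA mulnC -mulnA mulnC -aax; congr (_ %% _)%N; ring.
  apply: (mulrn_mod B8); rewrite /d'.
  have -> : (d + 7 * (a * b * c) + b * (c * a) = a * b * c * 8 + d)%N by ring.
  by rewrite modnMDl.
rewrite eA eB e4 (root2_mulr od' hb2) (root2_mull oa hb1) e1 mulrA -signr_addb.
congr (_ ^+ _ * _); congr nat_of_bool.
have -> : pm1_mod8 (a * d + 7 * (b * c)) = pm1_mod8 (a * d').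
  rewrite /pm1_mod8 /d'; suff -> : (a * d + 7 * (b * c) = a * (d + 7 * (a * b * c)) %[mod 8])%N by [].
  rewrite mulnDr; have -> : (a * (7 * (a * b * c)) = a * a * (7 * (b * c)))%N by ring.
  by rewrite -[in RHS]modnDmr aax modnDmr.
by rewrite pm1_mod8M //; case: (pm1_mod8 a); case: (pm1_mod8 d').
Qed.
End BasisChange.

(** * Galois conjugation *)

Lemma map_slope (F G : fieldType) (f : {rmorphism F -> G}) (W : weierstrass F)
  (W' : weierstrass G) : wa1 W' = f (wa1 W) -> wa2 W' = f (wa2 W) ->
  wa3 W' = f (wa3 W) -> wa4 W' = f (wa4 W) ->
  forall x1 y1 x2 y2, f (slope W x1 y1 x2 y2) = slope W' (f x1) (f y1) (f x2) (f y2).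
Proof.
move=> h1 h2 h3 h4 x1 y1 x2 y2; rewrite /slope (inj_eq (fmorph_inj f)) h1 h2 h3 h4.
by case: ifP => _; rewrite !(rmorphM, fmorphV, rmorphD, rmorphN, rmorphXn, rmorph_nat, rmorphB) /=.
Qed.

Lemma map_add_pt (F G : fieldType) (f : {rmorphism F -> G}) p q :
  map_pt f (add_pt (E F) p q) = add_pt (E G) (map_pt f p) (map_pt f q).
Proof.
case: p q => [[x1 y1]|] [[x2 y2]|] //; rewrite /add_pt [map_pt f (Some _)]/= [map_pt f (Some (x2, y2))]/=.
have -> : (f y1 == - f y2 - wa1 (E G) * f x2 - wa3 (E G)) =
   (y1 == - y2 - wa1 (E F) * x2 - wa3 (E F)).
  by rewrite -(inj_eq (fmorph_inj f)) /= !(rmorphM, rmorphB, rmorphN, rmorph1, rmorph0).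
rewrite (inj_eq (fmorph_inj f)); case: ifP => // _.
rewrite -(map_slope (f := f) (W := E F)) /=; last 4 first.
- by rewrite rmorph1.
- by rewrite rmorph1.
- by rewrite rmorph0.
- by rewrite rmorphN rmorph_nat.
by rewrite /= !(rmorphM, rmorphD, rmorphN, rmorphXn, rmorph1, rmorph0).
Qed.

Section Galois.
Variables (C : numClosedFieldType) (L : splittingFieldType rat).
Variables (iota : {rmorphism L -> C}) (sigma : gal_of {:L}).
Implicit Types A B P Q R T : ec_point (E C).

(** A relation, because [sigma] acts on [L] and not on [C]; it is functional and compatible with
    field operations. *)
Definition conjugate (z w : C) : Prop := exists x, iota x = z /\ iota (sigma x) = w.

Lemma conjugate_fun z w w' : conjugate z w -> conjugate z w' -> w = w'.
Proof. by move=> [x [<- <-]] [y [/fmorph_inj -> <-]]. Qed.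

Lemma conjugateD z w z' w' : conjugate z w -> conjugate z' w' -> conjugate (z + z') (w + w').
Proof. by move=> [x [<- <-]] [y [<- <-]]; exists (x + y); rewrite !rmorphD. Qed.

Lemma conjugateN z w : conjugate z w -> conjugate (- z) (- w).
Proof. by move=> [x [<- <-]]; exists (- x); rewrite !rmorphN. Qed.

Lemma conjugateB z w z' w' : conjugate z w -> conjugate z' w' -> conjugate (z - z') (w - w').
Proof. by move=> h /conjugateN; apply: conjugateD. Qed.

Lemma conjugateM z w z' w' : conjugate z w -> conjugate z' w' -> conjugate (z * z') (w * w').
Proof. by move=> [x [<- <-]] [y [<- <-]]; exists (x * y); rewrite !rmorphM. Qed.

Lemma conjugateV z w : conjugate z w -> conjugate z^-1 w^-1.
Proof. by move=> [x [<- <-]]; exists x^-1; rewrite !fmorphV. Qed.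

Lemma conjugateX n z w : conjugate z w -> conjugate (z ^+ n) (w ^+ n).
Proof. by move=> [x [<- <-]]; exists (x ^+ n); rewrite !rmorphXn. Qed.

Lemma conjugate_nat n : conjugate n%:R n%:R.
Proof. by exists n%:R; rewrite !rmorph_nat. Qed.

Lemma galois_mapsD P P' Q Q' : galois_maps iota sigma P P' ->
  galois_maps iota sigma Q Q' -> galois_maps iota sigma (ec_val (P + Q)) (ec_val (P' + Q')).
Proof.
move=> [p [hp hp']] [q [hq hq']]; exists (add_pt (E L) p q).
by rewrite !map_add_pt hp hq hp' hq'.
Qed.

Lemma galois_maps_muln n P P' : galois_maps iota sigma P P' ->
  galois_maps iota sigma (ec_val (P *+ n)) (ec_val (P' *+ n)).
Proof.
move=> h; elim: n => [|n IH]; first by exists None.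
by rewrite !mulrS; apply: galois_mapsD.
Qed.

Lemma galois_maps_fun P Q Q' : galois_maps iota sigma P Q ->
  galois_maps iota sigma P Q' -> Q = Q'.
Proof.
move=> [p [hp hq]] [p' [hp' hq']]; apply: val_inj; rewrite /= -hq -hq'.
suff -> : p = p' by [].
move: hp; rewrite -hp'; case: p p' {hq hq' hp'} => [[x y]|] [[x' y']|] //=.
by case=> /fmorph_inj -> /fmorph_inj ->.
Qed.

Lemma galois_maps_inj P P' Q : galois_maps iota sigma P Q ->
  galois_maps iota sigma P' Q -> P = P'.
Proof.
move=> [p [hp hq]] [p' [hp' hq']]; apply: val_inj; rewrite /= -hp -hp'.
suff -> : p = p' by [].
move: hq; rewrite -hq'; case: p p' {hp hp' hq'} => [[x y]|] [[x' y']|] //=.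
by case=> /fmorph_inj/fmorph_inj -> /fmorph_inj/fmorph_inj ->.
Qed.

Lemma galois_maps0 : galois_maps iota sigma (ec_val (0 : ec_point (E C))) (ec_val (0 : ec_point (E C))).
Proof. by exists None. Qed.

Lemma galois_mapsT0 : galois_maps iota sigma T0 T0.
Proof. by exists (Some (0, 0)); rewrite /= !rmorph0. Qed.

Lemma conjugate_pX P Q : galois_maps iota sigma P Q -> conjugate (pX P) (pX Q).
Proof.
move=> [p [hp hq]]; rewrite /pX -hp -hq; case: p {hp hq} => [[x y]|] /=.
  by exists x.
exact: (conjugate_nat 0).
Qed.

Lemma conjugate_pY P Q : galois_maps iota sigma P Q -> conjugate (pY P) (pY Q).
Proof.
move=> [p [hp hq]]; rewrite /pY -hp -hq; case: p {hp hq} => [[x y]|] /=.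
  apply: conjugateD; first by exists y.
  by apply: conjugateM; [exists x | apply: conjugateV; apply: conjugate_nat].
exact: (conjugate_nat 0).
Qed.

Lemma conjugate_sqr_half e e' P Q : conjugate e e' -> galois_maps iota sigma P Q ->
  conjugate (sqr_half e P) (sqr_half e' Q).
Proof.
move=> he h; have hX := conjugate_pX h; have hY := conjugate_pY h.
by do ![done | exact: conjugate_nat | apply: conjugateX | apply: conjugateB
   | apply: conjugateD | apply: conjugateM | apply: conjugateV].
Qed.

(** [root2] is a rational expression over Q in the coordinates of multiples of A and B. *)
Lemma conjugate_root2 A A' B B' :
  galois_maps iota sigma A A' -> galois_maps iota sigma B B' ->
  conjugate (root2 A B) (root2 A' B').
Proof.
move=> hA hB; have hXA (n : nat) := conjugate_pX (galois_maps_muln n hA).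
have hXB (n : nat) := conjugate_pX (galois_maps_muln n hB).
have h0 : conjugate 0 0 := conjugate_nat 0.
have hA2 := galois_maps_muln 2 hA; have hB2 := galois_maps_muln 2 hB.
apply: conjugateM (conjugateM (conjugateB (hXA 2) (hXB 2)) _) (conjugateV _).
  exact: conjugate_sqr_half (hXA 4) hB2.
apply: conjugateM (conjugate_sqr_half (hXA 4) hB).
exact: conjugateM (conjugate_sqr_half h0 hA2) (conjugate_sqr_half h0 hA).
Qed.
End Galois.

(** * The abscissa of phi at the halves of P *)

Section Halves.
Variable C : numClosedFieldType.
Implicit Types A B P Q R T : ec_point (E C).

(* The abscissa of the image of Q under phi. *)
Definition phiX Q : C := pX Q - 2%:R / pX Q.

(** The equation x(2Q) = 2 is a quartic in x; divided by x^2 it becomes u^2 - 8u - 2 = 0 for u = x -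
    2/x. *)
Lemma phiX_sqr Q : Q *+ 2 = P -> (phiX Q - 4%:R) ^+ 2 = 18%:R.
Proof.
move=> e; have n2 : Q *+ 2 != 0 by rewrite e.
have n0 : Q != 0 by apply: (@mulrn_neq0 _ 1 2).
have [hX _] := dblX n0 n2; rewrite e /= in hX.
have hY := pY2 Q; have Y0 : pY Q != 0 by rewrite pY_eq0.
have x0 : pX Q != 0.
  by apply: contra Y0 => /eqP x0; rewrite -sqrf_eq0 hY x0 /cubic !expr0n /= !mulr0 addr0 subr0.
move: hX; rewrite {1}/pX /= expr_div_n exprMn hY /cubic /phiX.
have : cubic (pX Q) != 0 by rewrite -hY sqrf_eq0.
rewrite /cubic; move: (pX Q) x0 => x x0 c0 hX.
have h4 : x ^+ 4 = 8%:R * x ^+ 3 + 6%:R * x ^+ 2 - 16%:R * x - 4%:R.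
  move/eqP: hX; rewrite -subr_eq0 => /eqP hX.
  apply/eqP; rewrite -subr_eq0; apply/eqP.
  rewrite -[RHS](mulr0 (- (4%:R * (x ^+ 3 + 5%:R / 4%:R * x ^+ 2 - 2%:R * x)))) -hX.
  by field; apply: contra c0 => /eqP c; apply/eqP; rewrite -[RHS](mul0r 4%:R^-1) -c; field.
by field: h4.
Qed.
End Halves.

(** * Halves of P and 2-torsion *)

Section Torsion.
Variable C : numClosedFieldType.
Implicit Types A B Q R T : ec_point (E C).

(** The nonzero roots of the cubic are (-5 + w) / 8 with w a square root of 153. *)
Lemma other_torsion2 : exists T : ec_point (E C), [/\ T != 0, T != T0 & T *+ 2 = 0].
Proof.
pose w : C := sqrtC 153%:R; have hw : w ^+ 2 = 153%:R by exact: sqrtCK.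
pose e : C := (w - 5%:R) / 8%:R.
have h : on_curve (E C) (Some (e, - e / 2%:R)).
  by apply/eqP; rewrite /= /e; field: hw.
exists (ECPoint h); split=> //.
  apply/eqP => /(congr1 (@pX C)); rewrite T0X /pX /= => e0.
  have : w ^+ 2 - 25%:R = 0.
    have -> : w = 5%:R by rewrite -[w](subrK 5%:R) -[w - _](divfK (_ : 8%:R != 0)) ?pnatr_eq0 // -/e e0 mul0r add0r.
    by ring.
  by rewrite hw -natrB // => /eqP; rewrite pnatr_eq0.
by apply/eqP; rewrite -pY_eq0 // /pY /= mulNr addNr.
Qed.

(** The formulas of [halving] are read backwards from chosen square roots. Only the abscissa of 2R
    is compared with that of Q, so R may have to be replaced by -R. *)
Lemma divisible2 Q : exists R, R *+ 2 = Q.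
Proof.
have [->|Q0] := eqVneq Q 0; first by exists 0; rewrite mul0rn.
have [T [n0 n1 e2]] := other_torsion2.
have [rt e10 e30 e13 _] := torsion2_roots n0 n1 e2.
set e1 := pX T in rt e10 e30 e13; set e3 := third_root e1 in rt e30 e13.
pose q := pX Q; pose r e := sqrtC (q - e).
have hr e : r e ^+ 2 = q - e by exact: sqrtCK.
pose x := q + r 0 * r e1 + r 0 * r e3 + r e1 * r e3.
pose Y := (r 0 + r e1) * (r 0 + r e3) * (r e1 + r e3).
have nr e e' : e != e' -> r e + r e' != 0.
  move=> n; apply: contra n; rewrite addr_eq0 => /eqP e0.
  by rewrite -(inj_eq (subrI q)) -!hr e0 sqrrN.
have Y0 : Y != 0 by rewrite !mulf_neq0 // nr // eq_sym.
have [h5 h2 hf] := rootsE rt.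
have hY : Y ^+ 2 = cubic x.
  have s e e' e'' : x = q + r e * r e' + r e * r e'' + r e' * r e'' ->
    x - e = (r e + r e') * (r e + r e'').
    move=> ->; transitivity ((q - e) + r e * r e' + r e * r e'' + r e' * r e''); first ring.
    by rewrite -hr; ring.
  rewrite hf (s 0 e1 e3) // (s e1 0 e3) ?(s e3 0 e1) /Y; [ring | |]; rewrite /x; ring.
have h : on_curve (E C) (Some (x, Y - x / 2%:R)).
  apply/eqP; rewrite /=; apply/eqP; rewrite -subr_eq0; apply/eqP.
  by rewrite -[RHS](subrr (cubic x)) -{1}hY /cubic; field.
pose R := ECPoint h.
have RX : pX R = x by [].
have RY : pY R = Y by rewrite /pY /= subrK.
have R0 : R != 0 by [].
have R2 : R *+ 2 != 0 by rewrite -pY_eq0 ?RY.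
have [g1 _ _ _] := halving rt R0 R2.
have g0 : sqr_half 0 R = r 0.
  have n2Y : 2%:R * Y != 0 by rewrite mulf_neq0 ?pnatr_eq0.
  rewrite (sqr_halfE _ rt) RX RY; apply: (mulIf n2Y); rewrite divfK //.
  have -> : (0 - e1) * (0 - e3) = (r e1 ^+ 2 - r 0 ^+ 2) * (r e3 ^+ 2 - r 0 ^+ 2).
    by rewrite !hr; ring.
  have -> : x = r 0 ^+ 2 + r 0 * r e1 + r 0 * r e3 + r e1 * r e3.
    by rewrite hr subr0.
  by rewrite /Y; ring.
have /(pX_inj R2 Q0) [e|e] : pX (R *+ 2) = pX Q.
- by rewrite -[LHS]subr0 -g1 g0 hr subr0.
- by exists R.
by exists (- R); rewrite mulNrn e opprK.
Qed.

Lemma divisible2X j Q : exists R, R *+ (2 ^ j) = Q.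
Proof.
elim: j Q => [|j IH] Q; first by exists Q.
have [R e] := divisible2 Q; have [R' e'] := IH R.
by exists R'; rewrite expnSr mulrnA e'.
Qed.

(** Translation by [T0] replaces x by -2/x, which exchanges the two terms of x - 2/x. *)
Lemma phiX_T0 Q : Q *+ 2 = P -> phiX (Q + T0) = phiX Q.
Proof.
move=> e; have n2 : Q *+ 2 != 0 by rewrite e.
have n0 : Q != 0 by apply: (@mulrn_neq0 _ 1 2).
have [T [t0 t1 t2]] := other_torsion2.
have [rt e10 e30 e13 _] := torsion2_roots t0 t1 t2.
have [_ _ _] := sqr_half_transl rt (T0_neq0 C) (T0_2 C) (T0X C) n0 n2.
have [_ h2 _] := rootsE rt.
have -> : (0 - pX T) * (0 - third_root (pX T)) = - 2%:R by rewrite [in RHS]h2; ring.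
rewrite !subr0 /phiX => ->.
(* At x = 0 all the inverses are 0 by convention, so both sides vanish. *)
have [->|x0] := eqVneq (pX Q) 0; last by field.
by rewrite invr0 !mulr0 invr0 mulr0.
Qed.

(** Equal values would give Q + T the abscissa of Q or of Q + [T0]. Equality of points is excluded
    by the choice of T; equality up to sign would give 4Q = 0, whereas 4Q = 2P is nonzero. *)
Lemma phiX_torsion2 Q T : Q *+ 2 = P -> T != 0 -> T != T0 -> T *+ 2 = 0 ->
  phiX (Q + T) != phiX Q.
Proof.
move=> e t0 t1 t2; have n2 : Q *+ 2 != 0 by rewrite e.
have n0 : Q != 0 by apply: (@mulrn_neq0 _ 1 2).
have n4 : Q *+ 4 != 0.
  rewrite (mulrnA Q 2 2) e -pY_eq0 // /pY /=.
  have -> : 2%:R + 2%:R / 2%:R = 3%:R :> C by field.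
  by rewrite pnatr_eq0.
have [rt e10 e30 e13 _] := torsion2_roots t0 t1 t2.
have [_ _ _] := sqr_half_transl rt (T0_neq0 C) (T0_2 C) (T0X C) n0 n2.
have [_ h2 _] := rootsE rt.
have -> : (0 - pX T) * (0 - third_root (pX T)) = - 2%:R by rewrite [in RHS]h2; ring.
rewrite !subr0 => hX.
have ne S : S *+ 2 = 0 -> Q + S != 0.
  move=> s2; apply: contra n2; rewrite addr_eq0 => /eqP ->.
  by rewrite mulNrn s2 oppr0.
have neN S S' : S *+ 2 = 0 -> S' *+ 2 = 0 -> Q + S <> - (Q + S').
  move=> s2 s2' /eqP; rewrite -addr_eq0 addrACA -mulr2n addr_eq0 => /eqP h.
  by case/eqP: n4; rewrite (mulrnA Q 2 2) h mulNrn mulrnDl s2 s2' addr0 oppr0.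
apply/eqP; rewrite /phiX => hu.
have Tn : Q + T0 != 0 by apply: ne; apply: T0_2.
have nT : Q + T != 0 by apply: ne.
have Y0 : pY Q != 0 by rewrite pY_eq0.
have x0 : pX Q != 0.
  by apply: contra Y0 => /eqP x0; rewrite -sqrf_eq0 pY2 x0 /cubic !expr0n /= !mulr0 addr0 subr0.
have x1 : pX (Q + T) != 0.
  have : pY (Q + T) != 0 by rewrite pY_eq0 // mulrnDl t2 addr0.
  by apply: contra => /eqP x1; rewrite -sqrf_eq0 pY2 x1 /cubic !expr0n /= !mulr0 addr0 subr0.
have : (pX (Q + T) - pX Q) * (pX (Q + T) - pX (Q + T0)) = 0.
  rewrite hX; move/eqP: hu; rewrite -subr_eq0 => /eqP hu.
  by rewrite -[RHS](mulr0 (pX (Q + T))) -hu; field; rewrite x0.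
move/eqP; rewrite mulf_eq0 !subr_eq0 => /orP[] /eqP /pX_inj [] // h.
- by case/eqP: t0; rewrite -[T](addKr Q) h addNr.
- by apply: (neN T 0) => //; rewrite ?mul0rn ?addr0.
- by case/eqP: t1; exact: addrI h.
by apply: (neN T T0) => //; exact: T0_2.
Qed.
End Torsion.

(** * Multiples of a point on a smooth curve, applied below to E' *)

Section Powers.
Variables (C : numClosedFieldType) (W : weierstrass C).
Hypothesis sm : smooth W.
Implicit Types P Q : ec_point W.

Lemma ec_mulD m n P : ec_mul (m + n) P = ec_add (ec_mul m P) (ec_mul n P).
Proof.
elim: m => [|m IH]; first by rewrite ec_0add.
by rewrite addSn /= -/(ec_mul _ _) IH ec_addA //; apply: many_points.
Qed.

Lemma ec_mulM m n P : ec_mul (m * n) P = ec_mul m (ec_mul n P).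
Proof. by elim: m => //= m IH; rewrite mulSn ec_mulD IH. Qed.
End Powers.

(** * The isogeny and doubling *)

Section Phi.
Variable C : numClosedFieldType.
Implicit Types Q R : ec_point (E C).

(** Iterating this gives the multiples by powers of 2 in [phi_mul2X]. *)
Lemma phi_dbl Q : phi (Q *+ 2) = ec_add (phi Q) (phi Q).
Proof.
have [->|Q0] := eqVneq Q 0; first by rewrite mul0rn; apply: val_inj.
have n8 : 8%:R != 0 :> C by rewrite pnatr_eq0.
apply: val_inj; change (phi_pt (ec_val (Q *+ 2)) =
  add_pt (E' C) (phi_pt (ec_val Q)) (phi_pt (ec_val Q))).
have [Q2 eQ2] : exists R, Q *+ 2 = R by exists (Q *+ 2).
rewrite (ec_valE Q0) eQ2.
have hY := pY2 Q; pose w := 2%:R * pY Q.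
have hw : w ^+ 2 = 4%:R * pX Q ^+ 3 + 5%:R * pX Q ^+ 2 - 8%:R * pX Q.
  by rewrite /w exprMn hY /cubic; field.
have Yw : pY Q = w / 2%:R by rewrite /w; field.
have [x0|x0] := eqVneq (pX Q) 0.
  have /eqP : pY Q == 0 by rewrite -sqrf_eq0 hY /cubic x0 !expr0n /= !mulr0 addr0 subr0.
  by move/eqP; rewrite pY_eq0 // eQ2 => /eqP ->; rewrite /phi_pt x0 eqxx.
rewrite /phi_pt (negPf x0) /=.
set u := (_ - _) / _; set v := (_ + _) / _.
(* This is the denominator of the tangent slope on E'. It vanishes when Y = 0 or x^2 + 2 = 0, that
   is when 2Q is 0 or [T0], the kernel of [phi]. *)
have e2v : 2%:R * v + u = 2%:R * (pX Q ^+ 2 + 2%:R) * pY Q / pX Q ^+ 2.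
  by rewrite /v /u; field.
have ev : (v == - v - 1 * u - 0) = (2%:R * v + u == 0).
  by rewrite -subr_eq0; congr (_ == _); ring.
rewrite eqxx ev e2v /= !mulf_eq0 invr_eq0 sqrf_eq0 (negPf x0) pnatr_eq0 orbF /=.
have [d0|d0] := eqVneq Q2 0.
  by rewrite d0; have /eqP -> : pY Q == 0; [rewrite pY_eq0 // eQ2 d0 | rewrite eqxx orbT].
have Y0 : pY Q != 0 by rewrite pY_eq0 // eQ2.
rewrite -eQ2 in d0; have [hX hY'] := dblX Q0 d0; rewrite eQ2 in d0 hX hY'.
(* The square of the half-function attached to [T0]; the product of the other two roots is -2. *)
have {}hX : pX Q2 = ((pX Q ^+ 2 + 2%:R) / (2%:R * pY Q)) ^+ 2.
  have w0 : w != 0 by rewrite mulf_neq0 ?pnatr_eq0.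
  by rewrite hX Yw; field: hw.
rewrite (negPf Y0) orbF (ec_valE d0) hX sqrf_eq0 mulf_eq0 invr_eq0 mulf_eq0 pnatr_eq0 (negPf Y0) /= orbF.
case: eqVneq => // n2.
rewrite /slope eqxx /= !mul1r addr0 e2v hY' hX /u /v.
rewrite Yw mulf_eq0 invr_eq0 pnatr_eq0 orbF in Y0.
rewrite Yw; move: (pX Q) w hw x0 Y0 n2 {hY hX hY' u v e2v ev Yw} => x w hw x0 Y0 n2.
congr (Some (_, _)).
  by field: hw; rewrite x0 Y0 n2.
by field: hw; rewrite x0 Y0 n2.
Qed.
End Phi.

(** * Multiples of 2-torsion elements, residues and determinants of size 2 *)

Lemma mulrz_torsion2 (V : zmodType) (x : V) (r : int) :
  x *+ 2 = 0 -> x *~ r = 0 \/ x *~ r = x.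
Proof.
move=> x2; have xN : - x = x by apply/eqP; rewrite eq_sym -addr_eq0 -mulr2n x2.
have xn n : x *+ n = 0 \/ x *+ n = x.
  rewrite (mulrn_mod (n := n %% 2) x2) ?modn_mod // modn2.
  by case: (odd n); [right; rewrite mulr1n | left].
case: r => n; first exact: xn.
by rewrite NegzE mulrNz -pmulrn; case: (xn n.+1) => ->; rewrite ?oppr0 ?xN; [left | right].
Qed.

Lemma mulrn_torsion2 (V : zmodType) (x : V) n : x *+ 2 = 0 -> x *+ n = x *+ odd n.
Proof. by move=> x2; apply: (mulrn_mod x2); rewrite modn2 modn_small //; case: (odd n). Qed.

Lemma modn_Zp (m p n : nat) (x : 'Z_m) : (1 < m)%N -> (p %| m)%N ->
  x = n%:R -> (x = n %[mod p])%N.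
Proof. by move=> m1 pm ->; rewrite val_Zp_nat // modn_dvdm. Qed.

Lemma det_mx22 (R : comNzRingType) (M : 'M[R]_2) :
  \det M = M 0 0 * M 1 1 - M 0 1 * M 1 0.
Proof.
rewrite (expand_det_row M 0) !big_ord_recl big_ord0 addr0 /cofactor !det_mx11.
rewrite !mxE /= expr0 mul1r expr1 mulN1r mulrN.
by congr (M _ _ * M _ _ - M _ _ * M _ _); apply: val_inj.
Qed.

(** * Reduction to the 8-torsion and comparison of the two actions of sigma *)

Section Main.
Variable C : numClosedFieldType.
Implicit Types Q R T : ec_point (E C).

Lemma phi_eq0 Q : phi Q = ec_zero -> Q = 0 \/ Q = T0.
Proof.
move=> /(congr1 (@ec_val _ _)) e.
have [->|Q0] := eqVneq Q 0; [by left | right].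
have x0 : pX Q = 0 by move: e; rewrite /= (ec_valE Q0) /=; case: eqVneq.
apply: eqPt => //; rewrite [RHS]/pY /= mul0r addr0; apply/eqP.
by rewrite -sqrf_eq0 pY2 x0 /cubic !expr0n /= !mulr0 addr0 subr0.
Qed.

Lemma phi_mul2X j Q : phi (Q *+ (2 ^ j)) = ec_mul (2 ^ j) (phi Q).
Proof.
elim: j => [|j IH]; first by rewrite mulr1n /= ec_add0.
rewrite expnSr mulrnA phi_dbl IH mulnC (ec_mulM (@smoothE' C)).
by rewrite /= ec_add0.
Qed.

(** The group generated by A and B contains 0, [T0] and a third point. With B = 0 it would be too
    small; with B = [T0], so it would be for A = 0 or A = [T0]. *)
Lemma torsion2_basis (A B : ec_point (E C)) :
  (forall T, T *+ 2 = 0 -> exists r s : int, T = A *~ r + B *~ s) ->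
  A *+ 2 = 0 -> B = 0 \/ B = T0 -> [/\ A != 0, A != T0 & B = T0].
Proof.
move=> h A2 hB; have [T [n0 n1 e2]] := other_torsion2 C.
have hT0 := T0_2 C.
have B2 : B *+ 2 = 0 by case: hB => ->; rewrite ?mul0rn.
have hg S : S *+ 2 = 0 -> [\/ S = 0, S = A, S = B | S = A + B].
  move=> /h [r [s ->]].
  case: (mulrz_torsion2 r A2) => ->; case: (mulrz_torsion2 s B2) => ->;
  rewrite ?add0r ?addr0; by [constructor 1|constructor 2|constructor 3|constructor 4].
case: hB hg => eB hg.
  have eA : A = T0.
    by case: (hg _ hT0) => [/eqP|->|/eqP|->] //; rewrite ?eB ?addr0 // (negPf (T0_neq0 C)).
  case: (hg _ e2) => e.
  - by rewrite e eqxx in n0.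
  - by rewrite e eA eqxx in n1.
  - by rewrite e eB eqxx in n0.
  by rewrite e eA eB addr0 eqxx in n1.
have T00 : T0 + T0 = 0 :> ec_point (E C) by rewrite -mulr2n.
split=> //; apply/eqP => eA; case: (hg _ e2) => e; move: n0 n1;
  by rewrite e ?eB ?eA ?add0r ?T00 ?eqxx.
Qed.

(** Stated over any [numClosedFieldType], where the group structure on E is available. *)
Lemma parity_iff_det_mod8 (k : nat) (hk : (3 <= k)%N)
  (Ak Bk : ec_point (E C)) (Ck Dk : ec_point (E' C))
  (hAB : gen_torsion (2 ^ k) Ak Bk) (hCD : gen_torsion (2 ^ k) Ck Dk)
  (hB : phi Bk = ec_mul 2 Dk)
  (L : splittingFieldType rat) (iota : {rmorphism L -> C})
  (betak : ec_point (E C)) (hbeta : ec_mul (2 ^ k) betak = P)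
  (sigma : gal_of {:L})
  (M : 'M['Z_(2 ^ k)]_2) (e f : 'Z_(2 ^ k))
  (hsA : galois_maps iota sigma Ak
           (ec_add (ec_mul (M 0 0) Ak) (ec_mul (M 0 1) Bk)))
  (hsB : galois_maps iota sigma Bk
           (ec_add (ec_mul (M 1 0) Ak) (ec_mul (M 1 1) Bk)))
  (hsbeta : galois_maps iota sigma betak
              (ec_add betak (ec_add (ec_mul e Ak) (ec_mul f Bk)))) :
  (e = 0 %[mod 2])%N <->
  (\det M = 1 %[mod 8])%N \/ (\det M = 7 %[mod 8])%N.
Proof.
have k8 : (8 %| 2 ^ k)%N by rewrite -(@dvdn_Pexp2l 2 3 k) in hk.
have k1 : (1 < 2 ^ k)%N by rewrite (leq_trans _ (dvdn_leq _ k8)) ?expn_gt0.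
have ek : k = (k - 3).+3 by rewrite -addn3 subnK.
set j := (k - 3)%N in ek.
rewrite !ec_mulE in hbeta hsA hsB hsbeta.
have e4 : (2 ^ j * 4 = 2 ^ j.+2)%N by rewrite -(addn2 j) expnD.
have e8 : (2 ^ j * 8 = 2 ^ k)%N by rewrite ek -(addn3 j) expnD.
have e2 : (2 ^ j.+2 * 2 = 2 ^ k)%N by rewrite ek -expnSr.
have hgen T : T *+ (2 ^ k) = 0 <-> exists r s : int, T = Ak *~ r + Bk *~ s.
  rewrite -ec_mulE; split=> [/hAB[r [s ->]] | [r [s ->]]]; last apply/hAB;
    by exists r, s; rewrite !ec_mulzE.
have hAk : Ak *+ (2 ^ k) = 0 by apply/hgen; exists 1, 0; rewrite mulr1z mulr0z addr0.
have hBk : Bk *+ (2 ^ k) = 0 by apply/hgen; exists 0, 1; rewrite mulr1z mulr0z add0r.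
have hDk : ec_mul (2 ^ k) Dk = ec_zero.
  by apply/hCD; exists (Posz 0), (Posz 1); rewrite /ec_mulz /ec_mul /= ec_0add ec_add0.
(* Here j + 2 = k - 1, and phi(2^(k-1) B_k) = 2^k D_k = 0. *)
have B1 : Bk *+ (2 ^ j.+2) = 0 \/ Bk *+ (2 ^ j.+2) = T0.
  by apply: phi_eq0; rewrite phi_mul2X hB -(ec_mulM (@smoothE' C)) e2.
have A12 : Ak *+ (2 ^ j.+2) *+ 2 = 0 by rewrite -mulrnA e2.
(* A 2-torsion point is 2^(k-1) R with R in the 2^k-torsion, so the multiples of A_k and B_k by
   2^(k-1) generate the 2-torsion. *)
have gen2 T : T *+ 2 = 0 ->
    exists r s : int, T = Ak *+ (2 ^ j.+2) *~ r + Bk *+ (2 ^ j.+2) *~ s.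
  have [R <-] := divisible2X j.+2 T; rewrite -mulrnA e2 => /hgen[r [s ->]].
  by exists r, s; rewrite mulrnDl !pmulrn ![_ *~ _%:Z *~ _]mulrzAC.
have [n0 n1 eB1] := torsion2_basis gen2 A12 B1.
pose A := Ak *+ (2 ^ j); pose B := Bk *+ (2 ^ j).
have A4 : A *+ 4 = Ak *+ (2 ^ j.+2) by rewrite -mulrnA e4.
have B4 : B *+ 4 = T0 by rewrite -mulrnA e4.
have hb : basis8 A B by split; rewrite ?A4 // -mulrnA e8.
set a := M 0 0 in hsA; set b := M 0 1 in hsA.
set c := M 1 0 in hsB; set d := M 1 1 in hsB.
have gA : galois_maps iota sigma A (ec_val (A *+ a + B *+ b)).
  rewrite /A /B ![_ *+ _ *+ nat_of_ord _]mulrnAC -mulrnDl.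
  exact: galois_maps_muln hsA.
have gB : galois_maps iota sigma B (ec_val (A *+ c + B *+ d)).
  rewrite /A /B ![_ *+ _ *+ nat_of_ord _]mulrnAC -mulrnDl.
  exact: galois_maps_muln hsB.
rewrite -A4 in n0 n1 A12.
have T02 := T0_2 C.
have g4 x y : (A *+ x + B *+ y) *+ 4 = A *+ 4 *+ odd x + T0 *+ odd y.
  rewrite mulrnDl -!mulrnA ![(_ * 4)%N]mulnC !mulrnA B4.
  by rewrite (mulrn_torsion2 x A12) (mulrn_torsion2 y T02).
(* For a even, sigma would send 4A to 0 or [T0], both fixed by sigma; injectivity then contradicts
   the choice of A. *)
have oa : odd a.
  apply/negPn/negP => na; have := galois_maps_muln 4 gA.
  rewrite g4 (negbTE na) add0r; case: (odd b) => h.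
    by case/eqP: n1; apply: galois_maps_inj h (galois_mapsT0 _ _).
  by case/eqP: n0; apply: galois_maps_inj h (galois_maps0 _ _).
(* 4B = [T0] is rational, hence fixed by sigma; this forces c even and d odd. *)
have eT0 : A *+ 4 *+ odd c + T0 *+ odd d = T0.
  have := galois_maps_muln 4 gB; rewrite g4 B4 => h.
  by apply: galois_maps_fun h (galois_mapsT0 _ _).
have oc : ~~ odd c.
  apply/negP => oc; move: eT0; rewrite oc mulr1n; case: (odd d) => h.
    by case/eqP: n0; apply: (addIr T0); rewrite add0r.
  by case/eqP: n1; rewrite -h addr0.
have od : odd d.
  by move: eT0; rewrite (negbTE oc) add0r; case: (odd d).
have cr := conjugate_root2 gA gB.
rewrite (root2_change_basis b hb oa oc od) in cr.
have s2 := root2_sqr hb.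
pose Q := betak *+ (2 ^ j.+2).
have Q2 : Q *+ 2 = P by rewrite -mulrnA e2.
have gQ : galois_maps iota sigma Q (ec_val (Q + (A *+ 4 *+ e + T0 *+ f))).
  rewrite A4 -eB1 ![_ *+ _ *+ nat_of_ord _]mulrnAC -!mulrnDl.
  exact: galois_maps_muln hsbeta.
have eQ : Q + (A *+ 4 *+ e + T0 *+ f) = Q + A *+ 4 *+ odd e + T0 *+ odd f.
  by rewrite addrA (mulrn_torsion2 e A12) (mulrn_torsion2 f T02).
rewrite {}eQ in gQ.
pose Q' := Q + A *+ 4 *+ odd e.
have Q'2 : Q' *+ 2 = P by rewrite mulrnDl Q2 [_ *+ odd e *+ 2]mulrnAC A12 mul0rn addr0.
have phiQ' : phiX (Q' + T0 *+ odd f) = phiX Q'.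
  by case: (odd f); [exact: phiX_T0 | rewrite addr0].
have even_e : (phiX Q' == phiX Q) = ~~ odd e.
  rewrite /Q'; case: (odd e); last by rewrite addr0 eqxx.
  by apply/negbTE/phiX_torsion2.
have cu : conjugate iota sigma (phiX Q) (phiX Q').
  have h := conjugate_pX gQ; rewrite -phiQ'.
  exact: conjugateB h (conjugateM (conjugate_nat _ _ _) (conjugateV h)).
set n := (a * d + 7 * (b * c))%N in cr.
set rt := root2 A B in cr s2.
have rt0 : rt != 0 by rewrite -sqrf_eq0 s2 pnatr_eq0.
(* Both sides have square 18; the unknown sign [eps] occurs again in [hu'] and cancels in [key]. *)
have [eps hu] : exists eps : bool, phiX Q - 4%:R = (-1) ^+ eps * (3%:R * rt).
  have : (phiX Q - 4%:R) ^+ 2 == (3%:R * rt) ^+ 2.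
    by rewrite phiX_sqr // exprMn s2; apply/eqP; ring.
  rewrite eqf_sqr => /orP[] /eqP ->; first by exists false; rewrite mul1r.
  by exists true; rewrite mulN1r.
(* The conjugate of [hu]: sigma acts on its left side by [cu] and on its right side by [cr]. *)
have hu' : phiX Q' - 4%:R = (-1) ^+ eps * (3%:R * ((-1) ^+ (~~ pm1_mod8 n) * rt)).
  have h1 := conjugateB cu (conjugate_nat iota sigma 4).
  have h2 := conjugateM (conjugateX eps (conjugateN (conjugate_nat iota sigma 1)))
    (conjugateM (conjugate_nat iota sigma 3) cr).
  by rewrite hu in h1; exact: conjugate_fun h1 h2.
have key : ~~ odd e = pm1_mod8 n.
  rewrite -even_e -(inj_eq (addIr (- 4%:R))) hu hu'.
  rewrite (inj_eq (mulfI (_ : (-1) ^+ eps != 0))) ?signr_eq0 //.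
  rewrite (inj_eq (mulfI (_ : 3%:R != 0))) ?pnatr_eq0 //.
  case: (pm1_mod8 n); rewrite /= ?mul1r ?eqxx // mulN1r.
  by apply/negbTE; rewrite eq_sym -subr_eq0 opprK -mulr2n mulrn_eq0.
have detM : (\det M = n %[mod 8])%N.
  (* -1 is 7 in [n] but 2^k - 1 in the natural-number form of the determinant; these agree modulo 8,
     which divides 2^k. *)
  have -> : (n = a * d + (2 ^ k - 1) * (b * c) %[mod 8])%N.
    rewrite -[in LHS]modnDmr -[in RHS]modnDmr -[in LHS]modnMml -[in RHS]modnMml.
    suff -> : (7 = 2 ^ k - 1 %[mod 8])%N by [].
    by case/dvdnP: k8 k1 => [[|q]] -> // _; rewrite mulSn -addnBAC // addnC modnMDl.
  apply: modn_Zp => //.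
  rewrite natrD !natrM natrB ?(ltnW k1) // !natr_Zp.
  by rewrite pchar_Zp // sub0r mulN1r det_mx22.
rewrite detM mod0n modn2; split=> [e0|h].
  have : pm1_mod8 n by rewrite -key; case: (odd e) e0.
  by case/orP => /eqP ->; [left | right].
have : pm1_mod8 n by rewrite /pm1_mod8; case: h => ->.
by rewrite -key => /negbTE ->.
Qed.
End Main.

Theorem theorem4p4 (R : realType) (k : nat) (hk : (3 <= k)%N)
  (Ak Bk : ec_point (E R[i])) (Ck Dk : ec_point (E' R[i]))
  (hAB : gen_torsion (2 ^ k) Ak Bk) (hCD : gen_torsion (2 ^ k) Ck Dk)
  (hA : phi Ak = Ck) (hB : phi Bk = ec_mul 2 Dk)
  (Kk : splittingFieldType rat) (iota : {rmorphism Kk -> R[i]})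
  (hK : generated_by iota (division_coord k))
  (betak : ec_point (E R[i])) (hbeta : ec_mul (2 ^ k) betak = P)
  (sigma : gal_of {:Kk}) (hsigma : sigma \in 'Gal({:Kk} / 1)%g)
  (M : 'M['Z_(2 ^ k)]_2) (e f : 'Z_(2 ^ k))
  (hsA : galois_maps iota sigma Ak
           (ec_add (ec_mul (M 0 0) Ak) (ec_mul (M 0 1) Bk)))
  (hsB : galois_maps iota sigma Bk
           (ec_add (ec_mul (M 1 0) Ak) (ec_mul (M 1 1) Bk)))
  (hsbeta : galois_maps iota sigma betak
              (ec_add betak (ec_add (ec_mul e Ak) (ec_mul f Bk)))) :
  (e = 0 %[mod 2])%N <->
  (\det M = 1 %[mod 8])%N \/ (\det M = 7 %[mod 8])%N.
Proof.
exact: (@parity_iff_det_mod8 (R[i] : numClosedFieldType) k hk Ak Bk Ck Dk hAB hCD hB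
  Kk iota betak hbeta sigma M e f hsA hsB hsbeta).
Qed.
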